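(* Let $\rho\in(0,1)$ and let $\mathbf{R}=\begin{pmatrix}1&\rho\\ \rho&1\end{pmatrix}$. Let $\mathbf{h}_1,\mathbf{h}_2\in\mathbb{C}^2$ be independent standard circularly-symmetric complex Gaussian random vectors (i.e. $\mathbb{E}\{\mathbf{h}_j\}=\mathbf{0}$, $\mathbb{E}\{\mathbf{h}_j\mathbf{h}_j^{\rm H}\}=\mathbf{I}_2$, $\mathbb{E}\{\mathbf{h}_j\mathbf{h}_j^{\rm T}\}=\mathbf{0}$), and set $\tilde{\mathbf{h}}_j=\mathbf{R}^{1/2}\mathbf{h}_j$ for $j=1,2$. Define the complex random variable $g=\tilde{\mathbf{h}}_1^{\rm H}\tilde{\mathbf{h}}_2/\|\tilde{\mathbf{h}}_2\|$ and ${\rm g}=|g|^2$. Then ${\rm g}$ has probability density function, for $x>0$, $$f_{\rm g}(x)=\frac{1-\rho^2}{2\rho}\left[\mathcal{F}(1+\rho,x)-\mathcal{F}(1-\rho,x)\right],$$ where for $0<\eta<2$ and $x>0$, $$\mathcal{F}(\eta,x)=\frac{\eta}{4(2-\eta)}\exp\left(-\frac{x}{\eta}\right)-\frac{2-x}{8}\exp\left(-\frac{x}{2}\right){\rm Ei}\left[x\left(\frac{1}{2}-\frac{1}{\eta}\right)\right].$$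
   Context: $\mathbf{R}^{1/2}$ denotes the positive semidefinite square root of $\mathbf{R}$; $(\cdot)^{\rm H}$ is conjugate transpose and $\|\cdot\|$ the Euclidean norm. ${\rm Ei}(z)=-\int_{-z}^{\infty}\frac{e^{-t}}{t}\,{\rm d}t$ is the exponential integral (for $z<0$), as in Gradshteyn–Ryzhik eq. (8.211/1). *)

(* Defs.v *)
From HB Require Import structures.
From mathcomp Require Import all_boot all_order all_algebra.
From mathcomp Require Import all_classical all_reals all_analysis.
From mathcomp.real_closed Require Import complex.
Set Implicit Arguments. Unset Strict Implicit. Unset Printing Implicit Defensive.
Import Order.TTheory GRing.Theory Num.Theory.
Import numFieldNormedType.Exports.
Local Open Scope classical_set_scope.
Local Open Scope ring_scope.

Definition Rmat {R : realType} (rho : R) : 'M[R]_2 :=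
  \matrix_(i < 2, j < 2) (if i == j then 1 else rho).

Definition psd {R : realType} {n : nat} (S : 'M[R]_n) : Prop :=
  S^T = S /\ forall v : 'cV[R]_n, 0 <= (v^T *m S *m v) 0 0.

Definition ctr {R : realType} {n : nat} (v : 'cV[R[i]]_n) : 'rV[R[i]]_n :=
  (map_mx (@conjc R) v)^T.

Definition cabs2 {R : realType} (z : R[i]) : R := (complex.Re z) ^+ 2 + (complex.Im z) ^+ 2.

Definition cvnorm {R : realType} {n : nat} (v : 'cV[R[i]]_n) : R :=
  Num.sqrt (\sum_(k < n) cabs2 (v k 0)).

(* Exponential integral Ei(z) = - int_{-z}^oo e^{-t}/t dt  (used for z < 0). *)
Definition Ei {R : realType} (z : R) : R :=
  - fine (\int[@lebesgue_measure R]_(t in `[(- z)%R, +oo[) (expR (- t) / t)%:E)%E.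

Definition Ffun {R : realType} (eta x : R) : R :=
  eta / (4 * (2 - eta)) * expR (- (x / eta))
  - (2 - x) / 8 * expR (- (x / 2)) * Ei (x * (2^-1 - eta^-1)).

Definition fg {R : realType} (rho x : R) : R :=
  (1 - rho ^+ 2) / (2 * rho) * (Ffun (1 + rho) x - Ffun (1 - rho) x).

(* Index of the 8 real Gaussian coordinates: (real/imaginary part, vector j, entry k). *)
Definition Idx := (bool * 'I_2 * 'I_2)%type.

Definition mutually_independent {R : realType} {d : measure_display}
  {T : measurableType d} (P : probability T R) {I : finType} (X : I -> T -> R) : Prop :=
  forall B : I -> set R, (forall i, measurable (B i)) ->
    P (\bigcap_(i in [set: I]) (X i @^-1` B i)) = (\prod_(i : I) P (X i @^-1` B i))%E.

Definition hvec {R : realType} {T : Type} (X : Idx -> T -> R) (j : 'I_2) (t : T)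
  : 'cV[R[i]]_2 :=
  \col_(k < 2) (X (false, j, k) t +i* X (true, j, k) t)%C.

Definition htil {R : realType} {T : Type} (S : 'M[R]_2) (X : Idx -> T -> R)
  (j : 'I_2) (t : T) : 'cV[R[i]]_2 :=
  map_mx (fun r => r%:C%C) S *m hvec X j t.

Definition gcplx {R : realType} {T : Type} (S : 'M[R]_2) (X : Idx -> T -> R) (t : T)
  : R[i] :=
  (ctr (htil S X 0 t) *m htil S X 1 t) 0 0 / (cvnorm (htil S X 1 t))%:C%C.

Definition gg {R : realType} {T : Type} (S : 'M[R]_2) (X : Idx -> T -> R) (t : T) : R :=
  cabs2 (gcplx S X t).

(* Main.v *)
Require Import Defs.
From HB Require Import structures.
From mathcomp Require Import all_boot all_order all_algebra.
From mathcomp Require Import all_classical all_reals all_analysis.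
From mathcomp Require Import measurable_realfun.
From mathcomp.real_closed Require Import complex.
From mathcomp Require Import ring lra.
Set Implicit Arguments. Unset Strict Implicit. Unset Printing Implicit Defensive.
Import Order.TTheory GRing.Theory Num.Theory.
Import numFieldNormedType.Exports.
Local Open Scope classical_set_scope.
Local Open Scope ring_scope.

(* Only [S^T S = R] matters: with [y = R h_2], [|g|^2 = |h_1^H y|^2 / (h_2^H R h_2)].
   Given [h_2], rotation invariance of the Gaussian makes [|h_1^H y|^2] equal in
   law to [|y|^2 V] with [V] standard exponential, and rotating [h_2] onto the
   eigenvectors [(1, 1)/sqrt 2] and [(1, -1)/sqrt 2] of [R] turns the remaining ratio
   into [(l^2 s + m^2 t)/(l s + m t)] with [l = 1 + rho], [m = 1 - rho] and [s], [t]
   independent standard exponentials.  Hence the density at [x] is the mean of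
   [e^(-x/w)/w] over the ratio [w].  Substituting [s = t r] leaves an integral over
   [r > 0] of [e^(-x/w) / w / (1 + r)^2], [w = w(r)], whose primitive is a multiple of
   [Ffun (w r) x], since
   [d Ffun (eta, x) / d eta = e^(-x/eta) / (eta (2 - eta)^2)]. *)

(** Laws are compared by integrating nonnegative measurable functions in iterated form, so that
    Tonelli's theorem and affine substitutions in one variable do the work of a planar change of
    variables. The price is some care on the null sets where a slope or a denominator vanishes. Real
    and imaginary parts have variance [1/2], which makes the squared modulus of a coordinate
    standard exponential. The squares [l^2], [m^2] in the ratio come from [|R h_2|^2], the first
    powers from [h_2^H R h_2]. The ratio is homogeneous of degree 0 in [(s, t)], hence a function of
    [r = s/t] alone, and integrating [t e^(-(1 + r) t)] over [t] produces the factor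
    [1 / (1 + r)^2]. As [r] runs from 0 to infinity, [w] rises from [m] to [l]: these endpoints give
    the two terms of [fg]. *)

(** * Integration against a measure given by a density *)

Section density.
Local Open Scope ereal_scope.
Context d (T : measurableType d) (R : realType).
Variables (mu nu : {measure set T -> \bar R}) (p : T -> R).
Hypotheses (p_ge0 : forall x, (0 <= p x)%R) (mp : measurable_fun setT p).
Hypothesis nuE : forall A, measurable A -> nu A = \int[mu]_(x in A) (p x)%:E.

Import HBNNSimple.

(** Both sides commute with increasing limits, so simple functions suffice; for these, linearity
    reduces the claim to [nuE] on the level sets. *)
Lemma ge0_integral_density (f : T -> \bar R) :
  measurable_fun setT f -> (forall x, 0 <= f x) ->
  \int[nu]_x f x = \int[mu]_x (f x * (p x)%:E).
Proof.
move=> mf f0; pose h := nnsfun_approx measurableT mf.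
have mpE : measurable_fun setT (EFin \o p) by exact/measurable_EFinP.
have -> : \int[nu]_x f x = limn (fun n => \int[nu]_x (h n x)%:E).
  rewrite -monotone_convergence//.
  - by apply: eq_integral => x _; apply/esym/cvg_lim => //; exact: cvg_nnsfun_approx.
  - by move=> n; exact/measurable_EFinP.
  - by move=> n x _; rewrite lee_fin.
  - by move=> x _ a b ab; rewrite lee_fin; exact/lefP/nd_nnsfun_approx.
have -> : \int[mu]_x (f x * (p x)%:E) =
    limn (fun n => \int[mu]_x ((h n x)%:E * (p x)%:E)).
  rewrite -monotone_convergence//.
  - apply: eq_integral => x _; apply/esym/cvg_lim => //.
    by apply: cvgeZr => //; exact: cvg_nnsfun_approx.
  - by move=> n; apply: emeasurable_funM => //; exact/measurable_EFinP.
  - by move=> n x _; rewrite mule_ge0 ?lee_fin.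
  - move=> x _ a b ab; rewrite lee_wpmul2r ?lee_fin//.
    exact/lefP/nd_nnsfun_approx.
congr (limn _); apply/funext => n.
transitivity (\sum_(y \in range (h n)) (y%:E * nu (h n @^-1` [set y]))).
  rewrite integral_nnsfun// sintegralE.
  by have -> : (h n) \_ setT = h n by apply/funext => x; rewrite patchE in_setT.
under [RHS]eq_integral => x _.
  rewrite fimfunE -fsumEFin// ge0_mule_fsuml; last first.
    by move=> r; rewrite nnfun_muleindic_ge0.
  over.
rewrite ge0_integral_fsum//; last 2 first.
- move=> r; apply: emeasurable_funM => //; apply/measurable_EFinP.
  by apply: measurable_funM.
- by move=> r x _; rewrite mule_ge0 ?lee_fin// -lee_fin nnfun_muleindic_ge0.
apply: eq_fsbigr => r _.
under eq_integral do rewrite EFinM -muleA.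
(* A negative [r] is not a value of [h n], so both sides vanish; the sign is needed to pull [r] out
   of the integral below. *)
have [r0|r0] := ltP r 0%R.
  rewrite preimage_nnfun0// measure0 mule0 integral0_eq// => x _.
  by rewrite indicE in_set0 mul0e mule0.
rewrite ge0_integralZl//; last 2 first.
- by apply: emeasurable_funM => //; exact/measurable_EFinP.
- by move=> x _; rewrite mule_ge0 ?lee_fin.
rewrite nuE//; congr (_ * _); rewrite [LHS]integral_mkcond.
by apply: eq_integral => x _; rewrite epatch_indic muleC.
Qed.

End density.

Lemma ge0_integral_density2 (R : realType) (p : R -> R)
    (mu nu : {sigma_finite_measure set (measurableTypeR R) -> \bar R})
    (F : R * R -> \bar R) :
  (forall x, 0 <= p x) -> measurable_fun setT p ->
  (forall A, measurable A -> nu A = \int[mu]_(x in A) (p x)%:E)%E ->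
  measurable_fun setT F -> (forall z, 0 <= F z)%E ->
  (\int[nu]_x \int[nu]_y F (x, y) =
   \int[mu]_x \int[mu]_y (F (x, y) * (p x * p y)%:E))%E.
Proof.
move=> p0 mp nuE mF F0.
have nu_int (f : R -> \bar R) : measurable_fun setT f -> (forall x, 0 <= f x)%E ->
    (\int[nu]_x f x = \int[mu]_x (f x * (p x)%:E))%E.
  exact: (@ge0_integral_density _ (measurableTypeR R) R mu nu p p0 mp nuE f).
rewrite nu_int; last 2 first.
- exact: (@measurable_fun_fubini_tonelli_F _ _ _ _ _ nu F mF F0).
- by move=> x; exact: integral_ge0.
apply: eq_integral => x _.
have mFx : measurable_fun setT (fun y => F (x, y)) by exact: measurableT_comp.
have mpE : measurable_fun setT (EFin \o p) by exact/measurable_EFinP.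
rewrite nu_int// muleC -ge0_integralZl//.
- by apply: eq_integral => y _; rewrite muleCA EFinM.
- exact: emeasurable_funM.
- by move=> y _; rewrite mule_ge0// lee_fin.
- by rewrite lee_fin.
Qed.

(** Gives the pushforward as a bundled measure whose construction stays hidden; only its values are
    exposed. *)
Lemma pushforward_measure_ex d d' (T1 : measurableType d) (T2 : measurableType d')
    (R : realType) (m : {measure set T1 -> \bar R}) (f : T1 -> T2) :
  measurable_fun setT f ->
  exists m' : {measure set T2 -> \bar R}, m' = pushforward m f :> (set T2 -> \bar R).
Proof.
move=> mf.
by exists (measure_function_pushforward__canonical__measure_function_Measure m mf).
Qed.

(** * Affine substitution for Lebesgue measure on the line *)

Section affine.
Context (R : realType).
Notation mu := (@lebesgue_measure R).

(** Substitutions such as [y = x u] have slope [x], so the null point [x = 0] has to be discarded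
    first. *)
Lemma integral_lebesgueD0 (h : R -> \bar R) : measurable_fun setT h ->
  (\int[mu]_x h x = \int[mu]_(x in setT `\ (0%R : R)) h x)%E.
Proof.
move=> mh; apply/esym/integral_setD1; first exact: measurableD.
exact: measurable_funTS.
Qed.

Let aff (a b : R) (x : R) : R := a * x + b.

Let maff a b : measurable_fun setT (aff a b).
Proof. by apply: measurable_funD => //; exact: measurable_funM. Qed.

Let aff_preimage (a b : R) (A : set (measurableTypeR R)) : a != 0 -> measurable A ->
  (mu (aff a b @^-1` A) = `|a|^-1%:E * mu A)%E.
Proof.
move=> a0 mA.
have na0 : 0 < `|a| by rewrite normr_gt0.
have [pm pmE] := pushforward_measure_ex mu (maff a b : measurable_fun setT
  (aff a b : measurableTypeR R -> measurableTypeR R)).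
pose m1 : {measure set (measurableTypeR R) -> \bar R} :=
  mscale (NngNum (normr_ge0 a)) pm.
(* Lebesgue measure is determined by its values on half-open intervals, so the rescaled pushforward
   [m1] need only be computed there. A negative slope moves the closed end of the interval to the
   left, without changing its length. *)
suff -> : mu A = m1 A.
  rewrite /m1 /= /mscale /= pmE /pushforward muleA -EFinM mulVf ?mul1e//.
  by rewrite gt_eqF.
apply: lebesgue_measure_unique => // _ [[u v]] _ <-.
rewrite /m1 /= /mscale /= pmE /pushforward.
suff E : (mu [set` `]u, v]] = `|a|%:E * mu (aff a b @^-1` [set` `]u, v]]))%E.
  exact: E.
have [agt0|ale0] := ltP 0 a.
  rewrite (_ : aff a b @^-1` _ = [set` `](u - b) / a, (v - b) / a]]); last first.
    apply/seteqP; split => x /=; rewrite !in_itv/= /aff.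
      by rewrite ltr_pdivrMr// ler_pdivlMr// ltrBlDr lerBrDr mulrC.
    by rewrite ltr_pdivrMr// ler_pdivlMr// ltrBlDr lerBrDr mulrC.
  rewrite !lebesgue_measure_itv/= !lte_fin ltr_pM2r ?invr_gt0// ltrD2r.
  case: ifPn => _; last by rewrite mule0.
  by rewrite -!EFinB -EFinM (gtr0_norm agt0); congr EFin; field.
have alt0 : a < 0 by rewrite lt_neqAle a0.
rewrite (_ : aff a b @^-1` _ = [set` `[(v - b) / a, (u - b) / a[]); last first.
  apply/seteqP; split => x /=; rewrite !in_itv/= /aff.
    by rewrite ltr_ndivlMr// ler_ndivrMr// ltrBlDr lerBrDr mulrC andbC.
  by rewrite ltr_ndivlMr// ler_ndivrMr// ltrBlDr lerBrDr mulrC andbC.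
rewrite !lebesgue_measure_itv/= !lte_fin ltr_nM2r ?invr_lt0// ltrD2r.
case: ifPn => _; last by rewrite mule0.
by rewrite -!EFinB -EFinM (ltr0_norm alt0); congr EFin; field.
Qed.

Lemma ge0_integral_affine (a b : R) (f : R -> \bar R) : a != 0 ->
  measurable_fun setT f -> (forall x, 0 <= f x)%E ->
  (\int[mu]_x f (a * x + b)%R = `|a|^-1%:E * \int[mu]_x f x)%E.
Proof.
move=> a0 mf f0; have ninv_ge0 : 0 <= `|a|^-1 by rewrite invr_ge0.
have := @ge0_integral_pushforward _ _ (measurableTypeR R) (measurableTypeR R) R
  _ (maff a b) mu setT f measurableT mf (fun x _ => f0 x).
rewrite preimage_setT => /esym Ha; rewrite [LHS]Ha.
rewrite (eq_measure_integral (mscale (NngNum ninv_ge0) mu)); last first.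
  by move=> maf A mA _; exact: (aff_preimage b a0 mA).
  exact: maff.
by rewrite ge0_integral_mscale.
Qed.

End affine.

(** * Rotation invariance of the planar Gaussian *)

Section gauss.
Context (R : realType).
Notation mu := (@lebesgue_measure R).

(** Law of the real or the imaginary part of a standard circularly symmetric complex Gaussian: the
    total variance 1 splits evenly. *)
Definition halfnormal : probability (measurableTypeR R) R :=
  normal_prob 0 (Num.sqrt (2^-1)).

Definition halfnormal_pdf (x : R) : R := (Num.sqrt pi)^-1 * expR (- x ^+ 2).
Notation gam := halfnormal.
Notation phi := halfnormal_pdf.

Lemma halfnormal_pdf_ge0 x : 0 <= phi x.
Proof. by rewrite mulr_ge0 ?expR_ge0// invr_ge0 sqrtr_ge0. Qed.

Lemma measurable_halfnormal_pdf : measurable_fun setT phi.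
Proof. by apply: measurable_funM => //; exact: measurable_gauss_fun. Qed.

Lemma halfnormal_pdfM x y : phi x * phi y = pi^-1 * expR (- (x ^+ 2 + y ^+ 2)).
Proof.
rewrite /halfnormal_pdf mulrACA -expRD -opprD -invfM -expr2 sqr_sqrtr//.
exact: pi_ge0.
Qed.

Lemma halfnormalE A : measurable A -> gam A = (\int[mu]_(x in A) (phi x)%:E)%E.
Proof.
move=> mA; rewrite /halfnormal /= /normal_prob; apply: eq_integral => x _.
congr EFin; rewrite normal_pdfE; last first.
  by rewrite gt_eqF// sqrtr_gt0 invr_gt0.
rewrite /normal_peak /normal_fun sqr_sqrtr ?invr_ge0// subr0 -mulrnAl.
by rewrite -[X in X *+ 2]mulr1 -mulr_natr mulr1 mulVf ?mul1r ?divr1.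
Qed.

Lemma ge0_integral_halfnormal2 (F : R * R -> \bar R) :
  measurable_fun setT F -> (forall z, 0 <= F z)%E ->
  (\int[gam]_x \int[gam]_y F (x, y) =
   \int[mu]_x \int[mu]_y (F (x, y) * (phi x * phi y)%:E))%E.
Proof.
exact: ge0_integral_density2 halfnormal_pdf_ge0 measurable_halfnormal_pdf halfnormalE.
Qed.

Let maff2 (a b c d : R) : measurable_fun setT
  (fun z : R * R => (a * z.1 + b * z.2, c * z.1 + d * z.2)).
Proof.
apply/measurable_fun_pairP; split => /=.
  by apply: measurable_funD; apply: measurable_funM.
by apply: measurable_funD; apply: measurable_funM.
Qed.

Lemma fubini_tonelli_lebesgue (F : R * R -> \bar R) :
  measurable_fun setT F -> (forall z, 0 <= F z)%E ->
  (\int[mu]_x \int[mu]_y F (x, y) = \int[mu]_y \int[mu]_x F (x, y))%E.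
Proof. by move=> mF F0; exact: (@fubini_tonelli _ _ _ _ _ mu mu F mF F0). Qed.

Lemma fubini_tonelli_halfnormal (F : R * R -> \bar R) :
  measurable_fun setT F -> (forall z, 0 <= F z)%E ->
  (\int[gam]_x \int[gam]_y F (x, y) = \int[gam]_y \int[gam]_x F (x, y))%E.
Proof. by move=> mF F0; exact: (@fubini_tonelli _ _ _ _ _ gam gam F mF F0). Qed.

Let integralZl (c : R) (f : R -> \bar R) :
  measurable_fun setT f -> (forall x, 0 <= f x)%E -> 0 <= c ->
  (\int[mu]_x (c%:E * f x) = c%:E * \int[mu]_x f x)%E.
Proof. by move=> mf f0 c0; rewrite ge0_integralZl. Qed.

(* Substituting first [u = a x + b y] for [x], then [y = b u - e a v], only ever
   moves one coordinate, so that the affine change of variables on the line suffices. *)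
Let rot_neq0 (a b e : R) (F : R * R -> \bar R) : a != 0 ->
  a ^+ 2 + b ^+ 2 = 1 -> e ^+ 2 = 1 ->
  measurable_fun setT F -> (forall z, 0 <= F z)%E ->
  (\int[gam]_x \int[gam]_y F (a * x + b * y, e * (b * x - a * y))%R =
   \int[gam]_x \int[gam]_y F (x, y))%E.
Proof.
move=> a0 ab1 e1 mF F0.
have e0 : e != 0 by apply: contra_eq_neq e1 => ->; rewrite expr0n eq_sym oner_eq0.
have ae0 : - a * e != 0 by rewrite mulf_neq0 ?oppr_eq0.
pose F1 z := F (a * z.1 + b * z.2, e * (b * z.1 - a * z.2))%R.
have mF1 : measurable_fun setT F1.
  apply: measurableT_comp => //.
  rewrite (_ : (fun _ => _) =
      fun z : R * R => (a * z.1 + b * z.2, (e * b) * z.1 + (- e * a) * z.2)).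
    exact: maff2.
  by apply/funext => z /=; congr pair; ring.
rewrite (ge0_integral_halfnormal2 mF1 (fun=> F0 _)).
rewrite (ge0_integral_halfnormal2 mF F0).
pose phi2 (z : R * R) := phi z.1 * phi z.2.
have phi2_ge0 z : 0 <= phi2 z by rewrite mulr_ge0 ?halfnormal_pdf_ge0.
have mphi2 : measurable_fun setT (EFin \o phi2).
  apply/measurable_EFinP; apply: measurable_funM => /=;
    by apply: measurableT_comp => //; exact: measurable_halfnormal_pdf.
pose G z := (F z * (phi2 z)%:E)%E.
have mG : measurable_fun setT G by exact: emeasurable_funM.
have G0 z : (0 <= G z)%E by rewrite mule_ge0// lee_fin.
(* With [u = a x + b y] one has [(b u - y) / a = b x - a y], because [a^2 + b^2 = 1]; so [H (u, y)]
   is the rotated integrand expressed in the new [u] and the old [y]. *)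
pose H z := G (z.1, e * ((b * z.1 - z.2) / a))%R.
have mH : measurable_fun setT H.
  apply: measurableT_comp => //.
  rewrite (_ : (fun _ => _) =
      fun z : R * R => (1 * z.1 + 0 * z.2, (e * b / a) * z.1 + (- e / a) * z.2)).
    exact: maff2.
  by apply/funext => z /=; congr pair; [ring|field].
have H0 z : (0 <= H z)%E by exact: G0.
transitivity (\int[mu]_y \int[mu]_x H (a * x + b * y, y)%R)%E.
  transitivity (\int[mu]_y \int[mu]_x (F1 (x, y) * (phi2 (x, y))%:E))%E.
    apply: (@fubini_tonelli_lebesgue (fun z => F1 z * (phi2 z)%:E)%E).
      exact: emeasurable_funM.
    by move=> z; rewrite mule_ge0 ?lee_fin// F0.
  apply: eq_integral => y _; apply: eq_integral => x _.
  rewrite /F1 /H /G /=.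
  have -> : (b * (a * x + b * y) - y) / a = b * x - a * y.
    have -> : b * (a * x + b * y) - y = a * (b * x - a * y).
      have -> : b * (a * x + b * y) - y = b * (a * x + b * y) - (a ^+ 2 + b ^+ 2) * y.
        by rewrite ab1 mul1r.
      by ring.
    by rewrite mulrC mulKf.
  (* The product density depends only on [x^2 + y^2], which the orthogonal map preserves. *)
  congr (_ * _%:E)%E; rewrite /phi2 /= !halfnormal_pdfM; congr (_ * expR (- _)).
  transitivity ((a ^+ 2 + b ^+ 2) * (x ^+ 2 + y ^+ 2)).
    by rewrite ab1 mul1r.
  transitivity ((a * x + b * y) ^+ 2 + e ^+ 2 * (b * x - a * y) ^+ 2); last by ring.
  by rewrite e1; ring.
transitivity (\int[mu]_y (`|a|^-1%:E * \int[mu]_x H (x, y)))%E.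
  apply: eq_integral => y _.
  rewrite (ge0_integral_affine (b * y) (f := fun x => H (x, y)))//.
    exact: measurableT_comp.
rewrite (integralZl (f := fun y => \int[mu]_x H (x, y))%E); last 3 first.
- exact: (@measurable_fun_fubini_tonelli_G _ _ _ _ _ mu H mH H0).
- by move=> y; apply: integral_ge0 => x _; exact: G0.
- by rewrite invr_ge0.
apply: (etrans (congr1 (fun I => `|a|^-1%:E * I)%E
  (esym (fubini_tonelli_lebesgue mH H0)))).
(* The second substitution has slope [- a e], of absolute value [|a|]; its Jacobian cancels that of
   the first. *)
transitivity (`|a|^-1%:E * \int[mu]_x (`|a|%:E * \int[mu]_y G (x, y)))%E.
  congr (_ * _)%E; apply: eq_integral => x _.
  have := @ge0_integral_affine R (- a * e) (b * x) (fun y => H (x, y)) ae0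
    (measurableT_comp mH (pair1_measurable x)) (fun=> G0 _).
  have -> : `|- a * e| = `|a|.
    rewrite normrM normrN; suff -> : `|e| = 1 by rewrite mulr1.
    by apply/eqP; rewrite -sqrp_eq1// real_normK ?num_real// e1.
  move=> E; transitivity (`|a|%:E * (`|a|^-1%:E * \int[mu]_y H (x, y)))%E.
    by rewrite muleA -EFinM mulfV ?mul1e// normr_eq0.
  apply: (etrans (congr1 (fun I => `|a|%:E * I)%E (esym E))).
  apply: (congr1 (fun I => `|a|%:E * I)%E).
  apply: eq_integral => y _; rewrite /H /=.
  congr (G (_, _)).
  transitivity (e ^+ 2 * y); first by field.
  by rewrite e1 mul1r.
rewrite (integralZl (f := fun x => \int[mu]_y G (x, y))%E)//; last 2 first.
- exact: (@measurable_fun_fubini_tonelli_F _ _ _ _ _ mu G mG G0).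
- by move=> x; exact: integral_ge0.
by rewrite muleA -EFinM mulVf ?mul1e// normr_eq0.
Qed.

(** After division by the norm of [(a, b)] the map is a reflection. Its coefficients are those of
    [conj (x + i y) (a + i b)], the form in which entries of [h_1^H y] occur. *)
Lemma halfnormal_rotation (a b : R) (F : R * R -> \bar R) :
  measurable_fun setT F -> (forall z, 0 <= F z)%E ->
  (\int[gam]_x \int[gam]_y F (a * x + b * y, b * x - a * y)%R =
   \int[gam]_x \int[gam]_y
     F (Num.sqrt (a ^+ 2 + b ^+ 2) * x, Num.sqrt (a ^+ 2 + b ^+ 2) * y)%R)%E.
Proof.
move=> mF F0; set r := Num.sqrt _.
have r2 : r ^+ 2 = a ^+ 2 + b ^+ 2 by rewrite sqr_sqrtr// addr_ge0 ?sqr_ge0.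
have [r0|r0] := eqVneq r 0.
  have ab0 : (a ^+ 2 == 0) && (b ^+ 2 == 0).
    by rewrite -paddr_eq0 ?sqr_ge0// -r2 r0 expr0n.
  move: ab0; rewrite !sqrf_eq0 => /andP[/eqP a0 /eqP b0].
  rewrite r0 {r r2 r0}a0 b0.
  by apply: eq_integral => x _; apply: eq_integral => y _; rewrite !mul0r addr0 subr0.
pose Fr (z : R * R) := F (r * z.1, r * z.2)%R.
have mFr : measurable_fun setT Fr.
  apply: measurableT_comp => //.
  rewrite (_ : (fun _ => _) = fun z : R * R => (r * z.1 + 0 * z.2, 0 * z.1 + r * z.2)).
    exact: maff2.
  by apply/funext => z /=; congr pair; ring.
have Fr0 z : (0 <= Fr z)%E by exact: F0.
have r1 : (a / r) ^+ 2 + (b / r) ^+ 2 = 1.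
  by rewrite !expr_div_n -mulrDl -r2 mulfV// sqrf_eq0.
rewrite -[RHS]/(\int[gam]_x \int[gam]_y Fr (x, y))%E.
have [a0|a0] := eqVneq a 0; last first.
  have ar0 : a / r != 0 by rewrite mulf_neq0 ?invr_eq0.
  rewrite -(rot_neq0 ar0 r1 (expr1n _ 2) mFr Fr0).
  apply: eq_integral => x _; apply: eq_integral => y _; rewrite /Fr /=.
  by congr (F (_, _)); field.
have br0 : b / r != 0.
  apply: contra_eq_neq r1 => ->; rewrite a0 mul0r expr0n /= addr0.
  by rewrite eq_sym oner_eq0.
(* When [a = 0], exchanging [x] and [y] makes [b / r] the leading coefficient; the exchange flips
   the sign of the second component, whence [e = -1]. *)
have e1 : (-1 : R) ^+ 2 = 1 by rewrite sqrrN expr1n.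
rewrite addrC in r1.
rewrite -(rot_neq0 br0 r1 e1 mFr Fr0).
pose Fab (z : R * R) := F (a * z.1 + b * z.2, b * z.1 - a * z.2)%R.
have Fab0 z : (0 <= Fab z)%E by exact: F0.
have mFab : measurable_fun setT Fab.
  apply: measurableT_comp => //.
  rewrite (_ : (fun _ => _) =
      fun z : R * R => (a * z.1 + b * z.2, b * z.1 + - a * z.2)).
    exact: maff2.
  by apply/funext => z /=; congr pair; ring.
apply: (etrans (fubini_tonelli_halfnormal mFab Fab0)).
apply: eq_integral => x _; apply: eq_integral => y _; rewrite /Fr /Fab /=.
by congr (F (_, _)); field.
Qed.

End gauss.

(** * The squared modulus of a complex Gaussian is standard exponential *)

Section polar.
Context (R : realType).
Notation mu := (@lebesgue_measure R).
Notation gam := (@halfnormal R).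

Let integral_sqr_expR (c s : R) : 0 < c -> 0 <= s ->
  (\int[mu]_(x in `]s, +oo[) (x * expR (- (c * x ^+ 2)))%:E =
   ((c *+ 2)^-1 * expR (- (c * s ^+ 2)))%:E)%E.
Proof.
move=> c0 s0.
pose F x : R := - ((c *+ 2)^-1 * expR (- (c * x ^+ 2))).
have dF (x : R) : is_derive x (1:R) F (x * expR (- (c * x ^+ 2))).
  rewrite /F; apply: is_derive_eq.
  rewrite /GRing.scale /= !mulr1; set e := expR _.
  by field; rewrite gt_eqF.
have cf : continuous (fun x : R => x * expR (- (c * x ^+ 2))).
  move=> x; apply: cvgM; first exact: cvg_id.
  apply: (@continuous_comp _ _ _ (fun x : R => - (c * x ^+ 2)) expR).
    by apply: cvgN; apply: cvgM; [exact: cvg_cst|exact: exprn_continuous].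
  exact: continuous_expR.
rewrite integral_itv_obnd_cbnd; last first.
  by apply/measurable_EFinP; apply: measurable_funTS; exact: continuous_measurable_fun.
rewrite (@ge0_continuous_FTC2y _ _ F s 0).
- by rewrite /F -EFinB sub0r opprK.
- by move=> x sx; rewrite mulr_ge0 ?expR_ge0// (le_trans s0).
- exact: continuous_subspaceT.
- rewrite /F -oppr0 -[X in - X](mulr0 ((c *+ 2)^-1)); apply: cvgN; apply: cvgMr.
  have -> : (fun x : R => expR (- (c * x ^+ 2))) =
      (fun z => expR (- z)) \o (fun x => c * x ^+ 2) by [].
  apply: cvg_comp; last exact: cvgr_expR.
  apply: gt0_cvgMry => //; exact: cvgr_expr2.
- by move=> x _; have [] := dF x.
- apply: cvg_at_right_filter; apply: differentiable_continuous.
  by apply/derivable1_diffP; have [] := dF s.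
- by move=> x _; rewrite derive1E; have [] := dF x.
Qed.

Let integral_arctan : (\int[mu]_x ((1 + x ^+ 2)^-1)%:E = (pi : R)%:E)%E.
Proof.
have c0 (x : R) : 0 < 1 + x ^+ 2 by rewrite ltr_pwDl ?sqr_ge0.
have cf : continuous (fun x : R => (1 + x ^+ 2)^-1).
  move=> x; apply: cvgV; first by rewrite gt_eqF.
  by apply: cvgD; [exact: cvg_cst|exact: exprn_continuous].
rewrite ge0_symfun_integralT//; last 2 first.
- by move=> x; rewrite invr_ge0 ltW.
- by move=> x /=; rewrite sqrrN.
rewrite -set_itvcy (@ge0_continuous_FTC2y _ _ (@atan R) 0 (pi / 2)).
- by rewrite atan0 sube0 -EFinM mulrC divfK.
- by move=> x _; rewrite invr_ge0 ltW.
- exact: continuous_subspaceT.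
- exact: cvgy_atan.
- by move=> x _; exact: derivable_atan.
- by apply: cvg_at_right_filter; exact: continuous_atan.
- by move=> x _; rewrite derive1_atan.
Qed.

(** The planar Gaussian density as a function of the squared radius [s], cut off below [t]. *)
Let tail_density (t s : R) : R := \1_`]t, +oo[ s * (pi^-1 * expR (- s)).

Let tail_density_ge0 t s : 0 <= tail_density t s.
Proof. by rewrite !mulr_ge0 ?expR_ge0// invr_ge0 pi_ge0. Qed.

Let measurable_tail_density t : measurable_fun setT (tail_density t).
Proof.
apply: measurable_funM; first exact: measurable_indic.
by apply: measurable_funM => //; apply: measurableT_comp.
Qed.

(** The integral over [x] left after [y = x u]: [c] stands for [1 + u^2], and [|x|] is the
    Jacobian. *)
Let integral_tail_density (t c : R) : 0 <= t -> 0 < c ->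
  (\int[mu]_x (`|x| * tail_density t (c * x ^+ 2))%:E =
   (pi^-1 * expR (- t) * c^-1)%:E)%E.
Proof.
move=> t0 c0; pose s := Num.sqrt (t / c).
have s0 : 0 <= s by exact: sqrtr_ge0.
have s2 : c * s ^+ 2 = t.
  by rewrite sqr_sqrtr ?divr_ge0 ?(ltW c0)// mulrC divfK// gt_eqF.
have tsE (x : R) : 0 <= x -> (t < c * x ^+ 2) = (s < x).
  by move=> x0; rewrite -s2 (ltr_pM2l c0) ltr_pXn2r// nnegrE.
pose g (x : R) := \1_`]s, +oo[ x * (x * expR (- (c * x ^+ 2))).
have g0 x : 0 <= g x.
  rewrite /g indicE; have [|_] := boolP (x \in _); last by rewrite mul0r.
  rewrite inE /= in_itv /= andbT => sx.
  by rewrite mul1r mulr_ge0 ?expR_ge0// (le_trans s0)// ltW.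
have mg : measurable_fun setT g.
  apply: measurable_funM; first exact: measurable_indic.
  apply: measurable_funM => //; apply: measurableT_comp => //.
  by apply: measurable_funN; apply: measurable_funM => //; exact: measurable_funX.
have intg : (\int[mu]_x (g x)%:E = ((c *+ 2)^-1 * expR (- t))%:E)%E.
  rewrite -s2 -integral_sqr_expR// [RHS]integral_mkcond.
  by apply: eq_integral => x _; rewrite /g epatch_indic -EFinM mulrC.
(* The integrand is even, and [g] vanishes up to [s >= 0], so for each [x] at most one summand is
   nonzero. *)
have key (x : R) : `|x| * tail_density t (c * x ^+ 2) = pi^-1 * (g x + g (- x)).
  rewrite /tail_density /g !indicE !mem_setE !in_itv /= !andbT.
  have [x0|x0] := leP 0 x.
    rewrite ger0_norm// tsE// [_ < - x](_ : _ = false); last first.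
      by apply/negbTE; rewrite -leNgt (le_trans _ s0)// oppr_le0.
    by rewrite mul0r addr0; ring.
  rewrite ltr0_norm// -[in t < _](sqrrN x) tsE ?oppr_ge0 ?ltW//.
  rewrite [s < x](_ : _ = false); last first.
    by apply/negbTE; rewrite -leNgt (le_trans (ltW x0)).
  by rewrite mul0r add0r sqrrN; ring.
under eq_integral do rewrite key EFinM EFinD.
have mgN : measurable_fun setT (fun x : R => g (- x)) by exact: measurableT_comp.
rewrite ge0_integralZl//; last 3 first.
- by apply: emeasurable_funD; exact/measurable_EFinP.
- by move=> x _; rewrite adde_ge0// lee_fin.
- by rewrite lee_fin invr_ge0 pi_ge0.
rewrite ge0_integralD//; last 4 first.
- by move=> x _; rewrite lee_fin.
- exact/measurable_EFinP.
- by move=> x _; rewrite lee_fin.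
- exact/measurable_EFinP.
have -> : (\int[mu]_x (g (- x))%:E = \int[mu]_x (g x)%:E)%E.
  have N10 : (-1 : R) != 0 by rewrite oppr_eq0 oner_eq0.
  have mgE : measurable_fun setT (EFin \o g) by exact/measurable_EFinP.
  have := @ge0_integral_affine R (-1) 0 (EFin \o g) N10 mgE (fun x => g0 x).
  rewrite normrN1 invr1 mul1e => <-.
  by apply: eq_integral => x _; rewrite /= addr0 mulN1r.
rewrite intg -EFinD -EFinM; congr EFin; set e := expR _.
by move: (@pi R) (lt0r_neq0 (pi_gt0 R)) => p p0; field; rewrite p0 gt_eqF.
Qed.

(* Substituting [y = x u] turns the planar Gaussian integral over
   [x^2 + y^2 > t] into [\int_u e^{-t} / (pi (1 + u^2))]. *)
Let halfnormal2_tail (t : R) : 0 <= t ->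
  (\int[gam]_x \int[gam]_y (\1_`]t, +oo[ (x ^+ 2 + y ^+ 2))%:E =
   (expR (- t))%:E)%E.
Proof.
move=> t0.
have msqr : measurable_fun setT (fun z : R * R => z.1 ^+ 2 + z.2 ^+ 2).
  by apply: measurable_funD; apply: measurable_funX.
rewrite (@ge0_integral_halfnormal2 _
  (fun z => (\1_`]t, +oo[ (z.1 ^+ 2 + z.2 ^+ 2))%:E)); last 2 first.
- by apply/measurable_EFinP; apply: (measurableT_comp _ msqr); exact: measurable_indic.
- by move=> z; rewrite lee_fin.
pose h z := (tail_density t (z.1 ^+ 2 + z.2 ^+ 2))%:E.
have mh : measurable_fun setT h.
  by apply/measurable_EFinP; exact: (measurableT_comp _ msqr).
have h0 z : (0 <= h z)%E by rewrite lee_fin.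
pose K (z : R * R) := (`|z.1| * tail_density t ((1 + z.2 ^+ 2) * z.1 ^+ 2))%:E.
have mK : measurable_fun setT K.
  apply/measurable_EFinP; apply: measurable_funM; first exact: measurableT_comp.
  apply: (measurableT_comp (measurable_tail_density t)).
  apply: measurable_funM; last exact: measurable_funX.
  by apply: measurable_funD => //; exact: measurable_funX.
have K0 z : (0 <= K z)%E by rewrite lee_fin mulr_ge0.
transitivity (\int[mu]_x \int[mu]_y h (x, y))%E.
  apply: eq_integral => x _; apply: eq_integral => y _.
  by rewrite /h -EFinM halfnormal_pdfM.
transitivity (\int[mu]_x \int[mu]_u K (x, u))%E.
  (* The substitution [y = x u] degenerates at [x = 0], which is removed from both sides. *)
  rewrite (integral_lebesgueD0
    (@measurable_fun_fubini_tonelli_F _ _ _ _ _ mu h mh h0)).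
  rewrite (integral_lebesgueD0
    (@measurable_fun_fubini_tonelli_F _ _ _ _ _ mu K mK K0)).
  apply: eq_integral => x; rewrite inE /= => -[_ /eqP x0].
  have E := @ge0_integral_affine R x 0 (fun y => h (x, y)) x0
    (measurableT_comp mh (pair1_measurable x)) (fun=> h0 _).
  transitivity (`|x|%:E * (`|x|^-1%:E * \int[mu]_y h (x, y)))%E.
    by rewrite muleA -EFinM mulfV ?mul1e// normr_eq0.
  have mhx : measurable_fun setT (fun u => h (x, x * u + 0)).
    apply: (measurableT_comp mh); apply: measurable_fun_pair.
      exact: measurable_cst.
    by apply: measurable_funD => //; exact: measurable_funM.
  have Z : (\int[mu]_u (`|x|%:E * h (x, x * u + 0)%R) =
      `|x|%:E * \int[mu]_u h (x, x * u + 0)%R)%E by apply: ge0_integralZl.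
  rewrite -E -Z.
  apply: eq_integral => u _; rewrite /h /K -EFinM /= addr0.
  by congr (_ * tail_density t _)%:E; ring.
rewrite fubini_tonelli_lebesgue//.
transitivity (\int[mu]_u ((pi^-1 * expR (- t))%:E * ((1 + u ^+ 2)^-1)%:E))%E.
  apply: eq_integral => u _; rewrite -EFinM -integral_tail_density//.
  by rewrite ltr_pwDl// sqr_ge0.
rewrite ge0_integralZl//; last 3 first.
- apply/measurable_EFinP; apply: measurable_funTS; apply: continuous_measurable_fun => x.
  apply: cvgV; first by rewrite gt_eqF// ltr_pwDl// sqr_ge0.
  by apply: cvgD; [exact: cvg_cst|exact: exprn_continuous].
- by move=> x _; rewrite lee_fin invr_ge0 addr_ge0// sqr_ge0.
- by rewrite lee_fin mulr_ge0 ?expR_ge0// invr_ge0 pi_ge0.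
by rewrite integral_arctan -EFinM mulrAC mulVf ?mul1r// gt_eqF// pi_gt0.
Qed.

Definition stdexp : probability (measurableTypeR R) R :=
  @exponential_distribution_exponential_prob__canonical__probability_measure_Probability
    R 1 ltr01.

Lemma stdexpE (A : set R) :
  stdexp A = (\int[mu]_(x in A) (exponential_pdf 1 x)%:E)%E.
Proof. by []. Qed.

Let stdexp_tail (t : R) : 0 <= t -> stdexp `]t, +oo[%classic = (expR (- t))%:E.
Proof.
move=> t0; rewrite stdexpE.
rewrite integral_itv_obnd_cbnd; last first.
  by apply/measurable_EFinP/measurable_funTS; exact: measurable_exponential_pdf.
pose F (x : R) := - expR (- x).
have dF (x : R) : is_derive x (1:R) F (expR (- x)).
  by rewrite /F; apply: is_derive_eq; rewrite /GRing.scale /= mulrN1 opprK.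
have cE : continuous (fun x : R => expR (- x)).
  by move=> x; apply: continuous_comp; [exact: continuousN|exact: continuous_expR].
transitivity (\int[mu]_(x in `[t, +oo[) (expR (- x))%:E)%E.
  apply: eq_integral => x; rewrite inE /= in_itv /= andbT => tx.
  by rewrite exponential_pdfE ?(le_trans t0)// mul1r mulN1r.
rewrite (@ge0_continuous_FTC2y _ _ F t 0).
- by rewrite /F -EFinB sub0r opprK.
- by move=> x _; exact: expR_ge0.
- exact: continuous_subspaceT.
- by rewrite -oppr0; apply: cvgN; exact: cvgr_expR.
- by move=> x _; have [] := dF x.
- by apply: cvg_at_right_filter; apply: cvgN; exact: cE.
- by move=> x _; rewrite derive1E; have [] := dF x.
Qed.

Let stdexp_tail_neg (t : R) : t < 0 -> stdexp `]t, +oo[%classic = 1%E.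
Proof.
move=> t0; rewrite stdexpE -(integral_exponential_pdf (@ltr01 R)) integral_mkcond.
apply: eq_integral => x _; rewrite patchE; case: ifPn => // xt.
rewrite lt0_exponential_pdf//; apply: le_lt_trans t0.
by rewrite leNgt; apply: contra xt => tx; rewrite inE /= in_itv /= andbT.
Qed.

Lemma ge0_integral_stdexp (f : R -> \bar R) :
  measurable_fun setT f -> (forall x, 0 <= f x)%E ->
  (\int[stdexp]_x f x = \int[mu]_x (f x * (exponential_pdf 1 x)%:E))%E.
Proof.
move=> mf f0; apply: ge0_integral_density => //.
- by move=> x; exact: exponential_pdf_ge0.
- exact: measurable_exponential_pdf.
Qed.

(** The law of [x^2 + y^2] and [stdexp] have the same tails, and the open right rays form a
    generating family closed under intersection, so the two measures coincide. *)
Lemma halfnormal_sqr_law (f : R -> \bar R) :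
  measurable_fun setT f -> (forall x, 0 <= f x)%E ->
  (\int[gam]_x \int[gam]_y f (x ^+ 2 + y ^+ 2)%R = \int[stdexp]_t f t)%E.
Proof.
move=> mf f0.
pose q (z : measurableTypeR R * measurableTypeR R) : measurableTypeR R :=
  z.1 ^+ 2 + z.2 ^+ 2.
have mq : measurable_fun setT q.
  by apply: measurable_funD; apply: measurable_funX.
have [m mE] := pushforward_measure_ex (gam \x gam)%E mq.
have int_m (g : R -> \bar R) : measurable_fun setT g -> (forall x, 0 <= g x)%E ->
    (\int[m]_t g t = \int[gam]_x \int[gam]_y g (x ^+ 2 + y ^+ 2)%R)%E.
  move=> mg g0.
  rewrite (eq_measure_integral (pushforward (gam \x gam)%E q)); last first.
    by move=> A mA _; rewrite mE.
  rewrite ge0_integral_pushforward// preimage_setT.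
  apply: (fubini_tonelli1 (fun z => g (q z))) => //.
  exact: measurableT_comp.
rewrite -int_m//; apply: eq_measure_integral => A mA _.
pose G : set (set (measurableTypeR R)) := [set B | exists t : R, B = `]t, +oo[%classic].
have uniq := @measure_unique _ R (measurableTypeR R) G
  (fun n => `]- (n%:R), +oo[%classic) _ _ _ _ m stdexp.
have mray (t : R) : m `]t, +oo[%classic = stdexp `]t, +oo[%classic.
  have E : m `]t, +oo[%classic =
      (\int[gam]_x \int[gam]_y (\1_`]t, +oo[ (x ^+ 2 + y ^+ 2))%:E)%E.
    rewrite -(int_m (fun s => (\1_`]t, +oo[ s)%:E)); last 2 first.
    - by apply/measurable_EFinP; exact: measurable_indic.
    - by move=> s; rewrite lee_fin.
    by rewrite integral_indic ?setIT.
  (* For [t < 0] the ray contains every value of [x^2 + y^2], and both measures give it mass 1. *)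
  have [t0|t0] := leP 0 t; first by rewrite E halfnormal2_tail// stdexp_tail.
  rewrite stdexp_tail_neg// E.
  have xyt (x y : R) : \1_`]t, +oo[ (x ^+ 2 + y ^+ 2) = 1 :> R.
    rewrite indicE mem_set//= in_itv /= andbT (lt_le_trans t0)//.
    by rewrite addr_ge0// sqr_ge0.
  under eq_integral do under eq_integral do rewrite xyt.
  under eq_integral do rewrite integral_cst//= probability_setT mul1e.
  by rewrite integral_cst//= probability_setT mul1e.
apply: uniq => //.
- exact: RGenOInfty.measurableE.
- move=> _ _ [s ->] [t ->]; exists (Num.max s t).
  apply/seteqP; split => x /=; rewrite !in_itv /= !andbT gt_max.
    by move=> [-> ->].
  by move=> /andP[].
- by move=> n; exists (- n%:R).
- apply/seteqP; split => // x _; exists (Num.bound `|x|) => //=.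
  rewrite in_itv /= andbT ltrNl (le_lt_trans _ (archi_boundP (normr_ge0 x)))//.
  by rewrite -normrN ler_norm.
- by move=> _ [t ->].
- move=> n; rewrite mray; apply: (@le_lt_trans _ _ 1%E); last exact: ltry.
  exact: probability_le1.
Qed.
End polar.

Ltac measurable_arith := repeat first
  [ assumption | exact: measurable_cst | exact: measurable_id | exact: measurable_fst
  | exact: measurable_snd
  | apply: measurable_fun_pair | apply: measurable_funB | apply: measurable_funD
  | apply: measurable_funM | apply: measurable_funX | apply: measurable_funN
  | apply: (measurableT_comp measurable_fst) | apply: (measurableT_comp measurable_snd)].

(** * Pairs of complex Gaussian coordinates, as four real ones *)

Section gauss4.
Context (R : realType).
Notation gam := (@halfnormal R).
Implicit Type F : (R * R) * (R * R) -> \bar R.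

Lemma measurable_halfnormal_integral2 d (T : measurableType d)
    (K : T * (R * R) -> \bar R) :
  measurable_fun setT K -> (forall z, 0 <= K z)%E ->
  measurable_fun setT (fun z => \int[gam]_x \int[gam]_y K (z, (x, y)))%E.
Proof.
move=> mK K0.
pose K1 (p : T * R * R) := K (p.1.1, (p.1.2, p.2)).
have mK1 : measurable_fun setT K1.
  by apply: (measurableT_comp mK); measurable_arith.
pose K2 (p : T * R) := (\int[gam]_y K1 (p, y))%E.
have mK2 : measurable_fun setT K2.
  by apply: (@measurable_fun_fubini_tonelli_F _ _ _ _ _ gam K1 mK1) => p; exact: K0.
apply: (@measurable_fun_fubini_tonelli_F _ _ _ _ _ gam K2 mK2) => p.
by apply: integral_ge0 => y _; exact: K0.
Qed.

(** Rotations act on consecutive pairs; exchanging the two middle variables passes between grouping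
    by complex entry and grouping by real and imaginary part. *)
Lemma halfnormal4_swap F : measurable_fun setT F -> (forall z, 0 <= F z)%E ->
  (\int[gam]_x \int[gam]_y \int[gam]_z \int[gam]_w F ((x, y), (z, w)) =
   \int[gam]_x \int[gam]_y \int[gam]_z \int[gam]_w F ((x, z), (y, w)))%E.
Proof.
move=> mF F0; apply: eq_integral => x _.
pose K (p : R * R * R) := F ((x, p.1.1), (p.1.2, p.2)).
have mK : measurable_fun setT K by apply: (measurableT_comp mF); measurable_arith.
apply: (@fubini_tonelli_halfnormal _ (fun p => \int[gam]_w K (p, w))%E).
  by apply: (@measurable_fun_fubini_tonelli_F _ _ _ _ _ gam K mK) => p; exact: F0.
by move=> p; apply: integral_ge0 => w _; exact: F0.
Qed.

Lemma halfnormal4_rotation (a b a' b' : R) F :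
  measurable_fun setT F -> (forall z, 0 <= F z)%E ->
  let r := Num.sqrt (a ^+ 2 + b ^+ 2) in
  let r' := Num.sqrt (a' ^+ 2 + b' ^+ 2) in
  (\int[gam]_x \int[gam]_y \int[gam]_z \int[gam]_w
     F ((a * x + b * y, b * x - a * y), (a' * z + b' * w, b' * z - a' * w))%R =
   \int[gam]_x \int[gam]_y \int[gam]_z \int[gam]_w
     F ((r * x, r * y), (r' * z, r' * w))%R)%E.
Proof.
move=> mF F0 r r'.
pose K (p : R * R) := (\int[gam]_z \int[gam]_w F (p, (r' * z, r' * w)%R))%E.
have mK : measurable_fun setT K.
  pose F' (z : (R * R) * (R * R)) := F (z.1, (r' * z.2.1, r' * z.2.2)).
  apply: (@measurable_halfnormal_integral2 _ _ F') => [|z]; last exact: F0.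
  by apply: (measurableT_comp mF); measurable_arith.
have K0 p : (0 <= K p)%E.
  by apply: integral_ge0 => z _; apply: integral_ge0 => w _; exact: F0.
apply: etrans (halfnormal_rotation a b mK K0).
apply: eq_integral => x _; apply: eq_integral => y _.
apply: (@halfnormal_rotation _ a' b' (fun p => F (_, p))) => [|p]; last exact: F0.
by apply: (measurableT_comp mF); measurable_arith.
Qed.

Let integral_halfnormal_cst (k : \bar R) : (\int[gam]_x k = k)%E.
Proof.
have -> : (\int[gam]_x k = k * gam setT)%E by exact: integral_cst.
by rewrite probability_setT mule1.
Qed.

(** The argument of [f] on the left is [|h_1^H y|^2] for the vector [y] with entries [a1 + i b1] and
    [a2 + i b2]. A rotation in each complex entry replaces these entries by their moduli [r1], [r2];
    after regrouping, a rotation by [(r1, r2)] in the real and in the imaginary parts leaves a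
    single complex Gaussian scaled by [|y|]. *)
Lemma halfnormal4_form_law (a1 b1 a2 b2 : R) (f : R -> \bar R) :
  measurable_fun setT f -> (forall x, 0 <= f x)%E ->
  (\int[gam]_x \int[gam]_y \int[gam]_z \int[gam]_w
     f ((a1 * x + b1 * y + (a2 * z + b2 * w)) ^+ 2 +
        (b1 * x - a1 * y + (b2 * z - a2 * w)) ^+ 2)%R =
   \int[@stdexp R]_t f ((a1 ^+ 2 + b1 ^+ 2 + a2 ^+ 2 + b2 ^+ 2) * t)%R)%E.
Proof.
move=> mf f0.
pose F (p : (R * R) * (R * R)) := f ((p.1.1 + p.2.1) ^+ 2 + (p.1.2 + p.2.2) ^+ 2).
have mF : measurable_fun setT F by apply: (measurableT_comp mf); measurable_arith.
have F0 p : (0 <= F p)%E by exact: f0.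
rewrite -[LHS]/(\int[gam]_x \int[gam]_y \int[gam]_z \int[gam]_w
  F ((a1 * x + b1 * y, b1 * x - a1 * y), (a2 * z + b2 * w, b2 * z - a2 * w))%R)%E.
rewrite halfnormal4_rotation//; set r1 := Num.sqrt _; set r2 := Num.sqrt _.
pose F1 (p : (R * R) * (R * R)) := F ((r1 * p.1.1, r1 * p.1.2), (r2 * p.2.1, r2 * p.2.2)).
have mF1 : measurable_fun setT F1 by apply: (measurableT_comp mF); measurable_arith.
rewrite -[LHS]/(\int[gam]_x \int[gam]_y \int[gam]_z \int[gam]_w F1 ((x, y), (z, w)))%E.
rewrite halfnormal4_swap//; last by move=> p; exact: F0.
(* Only the first component of each rotated pair is read; the others integrate out to 1. *)
pose F2 (p : (R * R) * (R * R)) := f (p.1.1 ^+ 2 + p.2.1 ^+ 2).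
have mF2 : measurable_fun setT F2 by apply: (measurableT_comp mf); measurable_arith.
have F20 p : (0 <= F2 p)%E by exact: f0.
have := halfnormal4_rotation r1 r2 r1 r2 mF2 F20.
rewrite -[X in X = _ -> _]/(\int[gam]_x \int[gam]_y \int[gam]_z \int[gam]_w
  F1 ((x, z), (y, w)))%E => ->.
set r := Num.sqrt _.
have r2E : r ^+ 2 = a1 ^+ 2 + b1 ^+ 2 + a2 ^+ 2 + b2 ^+ 2.
  rewrite sqr_sqrtr ?addr_ge0 ?sqr_ge0//.
  by rewrite !sqr_sqrtr ?addr_ge0 ?sqr_ge0// addrA.
rewrite -r2E.
have mfr : measurable_fun setT (fun t => f (r ^+ 2 * t)).
  by apply: (measurableT_comp mf); measurable_arith.
rewrite -(halfnormal_sqr_law mfr (fun=> f0 _)).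
apply: eq_integral => x _; rewrite /F2 /= integral_halfnormal_cst.
apply: eq_integral => y _; rewrite integral_halfnormal_cst.
by rewrite !exprMn mulrDr.
Qed.

(** The normalised sum and difference of two independent complex Gaussians are again independent
    complex Gaussians: [halfnormal4_rotation] with all coefficients [1/sqrt 2], acting on real and
    imaginary parts alike. *)
Lemma halfnormal4_sum_diff_law (F : R * R -> \bar R) :
  measurable_fun setT F -> (forall z, 0 <= F z)%E ->
  (\int[gam]_x \int[gam]_y \int[gam]_z \int[gam]_w
     F (((x + z) ^+ 2 + (y + w) ^+ 2) / 2, ((x - z) ^+ 2 + (y - w) ^+ 2) / 2)%R =
   \int[@stdexp R]_s \int[@stdexp R]_t F (s, t))%E.
Proof.
move=> mF F0.
pose a : R := (Num.sqrt 2)^-1.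
have a2 : a ^+ 2 = 2^-1 by rewrite exprVn sqr_sqrtr.
pose F1 (p : (R * R) * (R * R)) :=
  F (p.1.1 ^+ 2 + p.2.1 ^+ 2, p.1.2 ^+ 2 + p.2.2 ^+ 2).
have mF1 : measurable_fun setT F1 by apply: (measurableT_comp mF); measurable_arith.
have F10 p : (0 <= F1 p)%E by exact: F0.
transitivity (\int[gam]_x \int[gam]_y \int[gam]_z \int[gam]_w
   F1 ((a * x + a * y, a * x - a * y), (a * z + a * w, a * z - a * w))%R)%E.
  pose F2 (p : (R * R) * (R * R)) :=
    F1 ((a * p.1.1 + a * p.2.1, a * p.1.1 - a * p.2.1),
        (a * p.1.2 + a * p.2.2, a * p.1.2 - a * p.2.2)).
  have mF2 : measurable_fun setT F2 by apply: (measurableT_comp mF1); measurable_arith.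
  rewrite -[RHS]/(\int[gam]_x \int[gam]_y \int[gam]_z \int[gam]_w
     F2 ((x, z), (y, w)))%E.
  apply: etrans (halfnormal4_swap mF2 (fun=> F10 _)).
  apply: eq_integral => x _; apply: eq_integral => y _.
  apply: eq_integral => z _; apply: eq_integral => w _.
  rewrite /F2 /F1 /= -!mulrDr -!mulrBr !exprMn a2.
  by congr (F (_, _)); rewrite -mulrDr mulrC.
apply: (etrans (halfnormal4_rotation a a a a mF1 F10)); rewrite a2.
have -> : 2^-1 + 2^-1 = 1 :> R by field.
rewrite sqrtr1.
transitivity (\int[gam]_x \int[gam]_y \int[gam]_z \int[gam]_w F1 ((x, y), (z, w)))%E.
  apply: eq_integral => x _; apply: eq_integral => y _.
  by apply: eq_integral => z _; apply: eq_integral => w _; rewrite !mul1r.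
apply: (etrans (halfnormal4_swap mF1 F10)).
pose K (s : R) := (\int[@stdexp R]_t F (s, t))%E.
have mK : measurable_fun setT K.
  exact: (@measurable_fun_fubini_tonelli_F _ _ _ _ _ (@stdexp R) F mF F0).
have K0 s : (0 <= K s)%E by exact: integral_ge0.
apply: etrans (halfnormal_sqr_law mK K0).
apply: eq_integral => x _; apply: eq_integral => y _.
apply: (halfnormal_sqr_law (f := fun t => F (_, t))) => [|t]; last exact: F0.
by apply: (measurableT_comp mF); measurable_arith.
Qed.

End gauss4.

(** * From mutual independence to an iterated integral *)

Section joint_law.
Local Open Scope ereal_scope.
Context d (T : measurableType d) (R : realType) (P : probability T R).

(* Coordinates are added one at a time: [U] need only be independent of the
   rectangles [DD] in the coordinates still to come, so every step is an instance of
   the uniqueness of product measures. *)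
Definition indep_law d' (W : measurableType d') (U : T -> W)
    (mu : set W -> \bar R) (DD : set (set T)) :=
  forall C D, measurable C -> DD D -> P (U @^-1` C `&` D) = mu C * P D.

Definition add_events d' (W : measurableType d') (U : T -> W) (DD : set (set T)) :
    set (set T) :=
  [set D | exists B D', [/\ measurable B, DD D' & D = U @^-1` B `&` D']].

(** For fixed [D], the mass of [(U, V) \in C] within [D] is a measure in [C]. It factors on
    rectangles, since the condition on [V] can be absorbed into the event tested against [U]. *)
Lemma indep_law_pair d1 d2 (W1 : measurableType d1) (W2 : measurableType d2)
    (U : T -> W1) (V : T -> W2) (mu : {sigma_finite_measure set W1 -> \bar R})
    (nu : {finite_measure set W2 -> \bar R}) (DD : set (set T)) :
  measurable_fun setT U -> measurable_fun setT V -> DD `<=` measurable ->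
  indep_law U mu (add_events V DD) -> indep_law V nu DD ->
  indep_law (fun t => (U t, V t)) (mu \x nu) DD.
Proof.
move=> mU mV mDD lawU lawV C D mC DD_D.
have mD : measurable D by exact: mDD.
have mUV : measurable_fun setT (fun t => (U t, V t)) by exact: measurable_fun_pair.
have [m mE] := pushforward_measure_ex (mrestr P mD) mUV.
have PD_fin : P D \is a fin_num by exact: fin_num_measure.
have PD_ge0 : (0 <= fine (P D))%R by exact: fine_ge0.
(* Uniqueness is stated for a product of two measures, so the constant [P D] is carried as a scaling
   of [nu]. *)
pose p := NngNum PD_ge0.
have pE : (p%:num)%:E = P D by rewrite /= fineK.
have rect A B : measurable A -> measurable B ->
    m (A `*` B) = mu A * (mscale p nu) B.
  move=> mA mB; rewrite mE /mscale pE.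
  transitivity (P (U @^-1` A `&` (V @^-1` B `&` D))).
    by congr (P _); apply/seteqP; split => t /= [] => [[]|? []].
  rewrite lawU//; last by exists B, D.
  by rewrite lawV// (muleC (nu B)).
have E1 := product_measure_unique rect mC.
have E2 : (mu \x mscale p nu) C = mscale p (mu \x nu) C.
  apply: product_measure_unique => // A B mA mB.
  transitivity (p%:num%:E * (mu \x nu) (A `*` B)); first by [].
  by rewrite product_measure1E// muleCA.
transitivity (m C); first by rewrite mE.
by rewrite -E1 E2 /mscale pE muleC.
Qed.

Variables (I : finType) (X : I -> T -> R).
Hypothesis mX : forall i, measurable_fun setT (X i).
Hypothesis X_indep : mutually_independent P X.

(** Rectangles in the coordinates of [s]. For the empty list only the sure event remains, and
    [indep_law] then describes the law alone. *)
Fixpoint events (s : seq I) : set (set T) :=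
  if s is i :: s' then add_events (X i : T -> measurableTypeR R) (events s')
  else [set setT].

Lemma measurable_events s : events s `<=` measurable.
Proof.
elim: s => [|i s IHs] D /=; first by move=> ->.
move=> [B [D' [mB /IHs mD' ->]]]; apply: measurableI => //.
by rewrite -[X in measurable X]setTI; exact: mX.
Qed.

(** [mutually_independent] speaks of all indices at once, so a rectangle in part of the coordinates
    is padded with [setT]. *)
Let events_bigcap s D : uniq s -> events s D ->
  exists B : I -> set R, [/\ forall i, measurable (B i),
    forall i, i \notin s -> B i = setT &
    D = \bigcap_(i in [set: I]) (X i @^-1` B i)].
Proof.
elim: s D => [|i s IHs] D /=.
  move=> _ ->; exists (fun=> setT); split=> //.
  by apply/seteqP; split.
move=> /andP[is_ us] [C [D' [mC /(IHs _ us)[B [mB BT ->]] ->]]].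
exists (fun j => if j == i then C else B j); split=> [j|j|].
- by case: ifPn.
- by rewrite inE negb_or => /andP[/negbTE -> /BT].
- apply/seteqP; split=> t /=.
    move=> [Ct Bt] j _ /=; case: ifPn => [/eqP -> //|_]; exact: Bt.
  move=> Bt; split=> [|j _]; first by have := Bt i Logic.I; rewrite /= eqxx.
  have := Bt j Logic.I => /=; case: ifPn => // /eqP -> _.
  by rewrite BT.
Qed.

Lemma indep_law_events (nu : set R -> \bar R) i s :
  (forall A, measurable A -> P (X i @^-1` A) = nu A) ->
  uniq (i :: s) -> indep_law (X i : T -> measurableTypeR R) nu (events s).
Proof.
move=> Xnu /= /andP[is_ us] C D mC /(events_bigcap us)[B [mB BT ->]].
have -> : X i @^-1` C `&` \bigcap_(j in [set: I]) (X j @^-1` B j) =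
    \bigcap_(j in [set: I]) (X j @^-1` (if j == i then C else B j)).
  apply/seteqP; split=> t /=.
    move=> [Ct Bt] j _ /=; case: ifPn => [/eqP -> //|_]; exact: Bt.
  move=> Bt; split=> [|j _]; first by have := Bt i Logic.I; rewrite /= eqxx.
  have := Bt j Logic.I => /=; case: ifPn => // /eqP -> _.
  by rewrite BT.
(* Independence is used for both intersections; their factors differ only at [i], where the second
   has [setT], of mass 1. *)
rewrite !X_indep//; last by move=> j; case: ifPn.
rewrite (bigD1 i)//= eqxx Xnu// [in RHS](bigD1 i)//= BT//.
rewrite preimage_setT probability_setT mul1e; congr (_ * _).
by apply: eq_bigr => j /negbTE ->.
Qed.

Notation gam := (halfnormal R).
Hypothesis X_halfnormal : forall i (A : set R), measurable A ->
  P (X i @^-1` A) = gam A.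

Let has_law d' (W : measurableType d') (U : T -> W) mu (s : seq I) :=
  measurable_fun setT U /\ indep_law U mu (events s).

Let has_law1 i s : uniq (i :: s) ->
  has_law (X i : T -> measurableTypeR R) gam s.
Proof.
move=> us; split; first exact: mX.
by apply: (indep_law_events _ us) => A; exact: X_halfnormal.
Qed.

Notation mR := (measurableTypeR R).

(** The structure [subprobability] is preserved by this product, so it can be iterated up to eight
    factors. *)
Let prodg d' (W : measurableType d') (mu : subprobability W R) :
    subprobability (W * mR)%type R :=
  product_subprobability (mu, gam : subprobability mR R).

Let integral_prodg d' (W : measurableType d') (mu : subprobability W R)
    (F : W * mR -> \bar R) :
  measurable_fun setT F -> (forall z, 0 <= F z) ->
  \int[prodg mu]_z F z = \int[mu]_w \int[gam]_x F (w, x).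
Proof. by move=> mF F0; exact: (@fubini_tonelli1 _ _ _ _ _ mu gam F mF F0). Qed.

Let measurable_integral d' (W : measurableType d') (F : W * mR -> \bar R) :
  measurable_fun setT F -> (forall z, 0 <= F z) ->
  measurable_fun setT (fun w => \int[gam]_x F (w, x)).
Proof. by move=> mF F0; exact: (@measurable_fun_fubini_tonelli_F _ _ _ _ _ gam F mF F0). Qed.

Let has_law_pair d' (W : measurableType d') (U : T -> W)
    (mu : subprobability W R) i s :
  uniq (i :: s) -> has_law U mu (i :: s) ->
  has_law (fun t => (U t, X i t : measurableTypeR R)) (prodg mu) s.
Proof.
move=> us [mU lawU]; split; first exact: measurable_fun_pair (mX i).
apply: (@indep_law_pair _ _ _ _ U (X i : T -> measurableTypeR R) mu gam) => //.
- exact: mX.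
- exact: measurable_events.
- apply: indep_law_events us; exact: X_halfnormal.
Qed.

Let w1 : subprobability mR R := gam.
Let w2 : subprobability (mR * mR)%type R := prodg w1.
Let w3 : subprobability (mR * mR * mR)%type R := prodg w2.
Let w4 : subprobability (mR * mR * mR * mR)%type R := prodg w3.
Let w5 : subprobability (mR * mR * mR * mR * mR)%type R := prodg w4.
Let w6 : subprobability (mR * mR * mR * mR * mR * mR)%type R := prodg w5.
Let w7 : subprobability (mR * mR * mR * mR * mR * mR * mR)%type R := prodg w6.
Let w8 : subprobability (mR * mR * mR * mR * mR * mR * mR * mR)%type R := prodg w7.

Lemma halfnormal8_integral (i1 i2 i3 i4 i5 i6 i7 i8 : I)
    (F : R * R * R * R * R * R * R * R -> \bar R) :
  uniq [:: i1; i2; i3; i4; i5; i6; i7; i8] ->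
  measurable_fun setT F -> (forall z, 0 <= F z) ->
  \int[P]_t F (X i1 t, X i2 t, X i3 t, X i4 t, X i5 t, X i6 t, X i7 t, X i8 t) =
  \int[gam]_x1 \int[gam]_x2 \int[gam]_x3 \int[gam]_x4
  \int[gam]_x5 \int[gam]_x6 \int[gam]_x7 \int[gam]_x8
    F (x1, x2, x3, x4, x5, x6, x7, x8).
Proof.
move=> us mF F0.
have u2 : uniq [:: i2; i3; i4; i5; i6; i7; i8] := drop_uniq 1 us.
have u3 : uniq [:: i3; i4; i5; i6; i7; i8] := drop_uniq 2 us.
have u4 : uniq [:: i4; i5; i6; i7; i8] := drop_uniq 3 us.
have u5 : uniq [:: i5; i6; i7; i8] := drop_uniq 4 us.
have u6 : uniq [:: i6; i7; i8] := drop_uniq 5 us.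
have u7 : uniq [:: i7; i8] := drop_uniq 6 us.
have u8 : uniq [:: i8] := drop_uniq 7 us.
have l2 := has_law_pair (mu := w1) u2 (has_law1 us).
have l3 := has_law_pair (mu := w2) u3 l2.
have l4 := has_law_pair (mu := w3) u4 l3.
have l5 := has_law_pair (mu := w4) u5 l4.
have l6 := has_law_pair (mu := w5) u6 l5.
have l7 := has_law_pair (mu := w6) u7 l6.
have [m8 l8] := has_law_pair (mu := w7) u8 l7.
have E := ge0_integral_pushforward m8 P measurableT mF (fun z _ => F0 z).
rewrite preimage_setT in E.
rewrite -[LHS]E.
transitivity (\int[w8]_z F z).
  (* With no coordinate left to come, [D] is the whole space and [l8] identifies the image of [P]
     with [w8]; Tonelli then peels off one factor at a time. *)
  apply: eq_measure_integral => C mC _; have := l8 C setT mC erefl.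
  by rewrite setIT probability_setT mule1.
have ge0 d' (W : measurableType d') (G : W * mR -> \bar R) :
    (forall z, 0 <= G z) -> forall w, 0 <= \int[gam]_x G (w, x).
  by move=> G0 w; exact: integral_ge0.
have f8 := ge0 _ _ _ F0; have g8 := measurable_integral mF F0.
have f7 := ge0 _ _ _ f8; have g7 := measurable_integral g8 f8.
have f6 := ge0 _ _ _ f7; have g6 := measurable_integral g7 f7.
have f5 := ge0 _ _ _ f6; have g5 := measurable_integral g6 f6.
have f4 := ge0 _ _ _ f5; have g4 := measurable_integral g5 f5.
have f3 := ge0 _ _ _ f4; have g3 := measurable_integral g4 f4.
apply: (etrans (integral_prodg w7 mF F0)).
apply: (etrans (integral_prodg w6 g8 f8)).
apply: (etrans (integral_prodg w5 g7 f7)).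
apply: (etrans (integral_prodg w4 g6 f6)).
apply: (etrans (integral_prodg w3 g5 f5)).
apply: (etrans (integral_prodg w2 g4 f4)).
exact: (integral_prodg w1 g3 f3).
Qed.

End joint_law.

Lemma measurable_invr (R : realType) : measurable_fun setT (fun x : R => x^-1).
Proof.
rewrite -(setUv [set (0 : R)]); apply/measurable_funU => //.
  exact: measurableC.
split.
  by apply: (eq_measurable_fun (cst (0 : R)^-1)) => // x; rewrite inE => ->.
apply: open_continuous_measurable_fun; first exact/closed_openC/closed_eq.
by move=> x; rewrite inE /= => /eqP x0; apply: cvgV.
Qed.

(** * Derivatives of [Ei] and of [Ffun] in its first argument *)

Section exponential_integral.
Context (R : realType).
Notation mu := (@lebesgue_measure R).

Let f (t : R) : R := expR (- t) / t.

Let measurable_f : measurable_fun setT f.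
Proof.
apply: measurable_funM; last exact: measurable_invr.
by apply: measurableT_comp => //; exact: measurable_funN.
Qed.

Let integrable_f (a : R) : 0 < a -> mu.-integrable `[a, +oo[ (EFin \o f).
Proof.
move=> a0.
have ie : mu.-integrable `[a, +oo[ (EFin \o (fun t => a^-1 * exponential_pdf 1 t)).
  apply: (integrableS measurableT) => //.
  exact: (integrableZl measurableT a^-1 (integrable_exponential_pdf ltr01)).
apply: le_integrable ie => //.
  by apply/measurable_EFinP; exact: measurable_funTS.
move=> t /=; rewrite in_itv /= andbT => at_; have t0 := lt_le_trans a0 at_.
rewrite lee_fin exponential_pdfE ?(ltW t0)// mul1r mulN1r /f.
rewrite !ger0_norm ?divr_ge0 ?mulr_ge0 ?invr_ge0 ?expR_ge0 ?(ltW a0) ?(ltW t0)//.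
by rewrite mulrC ler_wpM2r ?expR_ge0// lef_pV2.
Qed.

Lemma is_derive_Ei (z : R) : z < 0 -> is_derive z (1 : R) (@Ei R) (expR z / z).
Proof.
(* Any base point strictly between 0 and [- z] would do: it avoids the pole of [f] and leaves [- z]
   interior for the fundamental theorem. The relation [EiE] below holds only near [z], which is
   enough for a derivative. *)
move=> z0; pose a := - z / 2.
have a0 : 0 < a by rewrite divr_gt0// oppr_gt0.
have az : a < - z by rewrite /a; lra.
pose F (y : R) := (\int[mu]_(t in `[a, y]) f t)%R.
pose C := (\int[mu]_(t in `[a, +oo[) f t)%R.
have EiE (y : R) : a < - y -> Ei y = F (- y) - C.
  move=> ay; rewrite -opprB; congr (- _).
  rewrite (@Rintegral_itvB R f (BLeft a) (BInfty _ false) (- y)) ?bnd_simp ?ltW//.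
    rewrite Rintegral_itv_obnd_cbnd//.
    apply: integrableS (integrable_f a0) => //.
    by apply: subset_itvr; rewrite bnd_simp ltW.
  exact: integrable_f.
have [dF F'] : derivable F (- z) 1 /\ F^`()%classic (- z) = f (- z).
  apply: (@continuous_FTC1_closed R f a (- z) (- z + 1)) => //.
  - by rewrite ltrDl.
  - by apply: integrableS (integrable_f a0) => //; exact: subset_itvl.
  - apply: cvgM; last by apply: cvgV; [rewrite oppr_eq0 lt_eqF|exact: cvg_id].
    apply: continuous_comp; last exact: continuous_expR.
    by apply: cvgN; exact: cvg_id.
have dF' : is_derive (- z) (1 : R) F (f (- z)) by apply: DeriveDef; rewrite -?F' ?derive1E.
apply: (@near_eq_is_derive _ _ _ (fun y => F (- y) - C)).
  near=> y; rewrite EiE// ltrNr; near: y.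
  by apply: lt_nbhsl; rewrite ltrNr.
have dN : is_derive z (1 : R) (fun y : R => - y) (-1) by exact: is_deriveNid.
have dFN := @is_derive1_comp R F (fun y => - y) z _ _ dF' dN.
apply: is_derive_eq; rewrite /f opprK subr0 mulrN1 invrN mulrN opprK//.
Unshelve. all: by end_near. Qed.

(** The product of [e^(-x/2)] with the exponential from the derivative of [Ei] is again
    [e^(-x/eta)]. The coefficient [(2 - x) / 8] makes the terms in [x] cancel, leaving
    [1/(2 (2 - eta)^2) + 1/(2 eta (2 - eta))]. *)
Lemma is_derive_Ffun (x eta : R) : 0 < x -> 0 < eta < 2 ->
  is_derive eta (1 : R) (@Ffun R ^~ x)
    (expR (- (x / eta)) / (eta * (2 - eta) ^+ 2)).
Proof.
move=> x0 /andP[e0 e2].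
have en0 : eta != 0 by rewrite gt_eqF.
have e2n0 : 2 - eta != 0 by rewrite subr_eq0 gt_eqF.
have e2n0' : 4 * (2 - eta) != 0 by rewrite mulf_neq0.
have z0 : x * (2^-1 - eta^-1) < 0.
  by rewrite pmulr_rlt0// subr_lt0 ltf_pV2 ?posrE.
have did := @is_derive_id R R eta 1.
have dV : is_derive eta (1 : R) (fun y : R => y^-1) (- eta ^- 2).
  by apply: is_derive_eq (@is_deriveV R id eta 1 1 en0 did) _; rewrite /GRing.scale /= mulr1.
have dz : is_derive eta (1 : R) (fun y : R => x * (2^-1 - y^-1)) (x / eta ^+ 2).
  apply: is_derive_eq (is_deriveZ x (is_deriveB (is_derive_cst (2^-1 : R) eta 1) dV)) _.
  by rewrite /GRing.scale /= sub0r opprK.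
have dE := @is_derive1_comp R (@Ei R) _ eta _ _ (is_derive_Ei z0) dz.
have dx : is_derive eta (1 : R) (fun y : R => expR (- (x / y)))
    (expR (- (x / eta)) * (x / eta ^+ 2)).
  have d1 : is_derive eta (1 : R) (fun y : R => - (x / y)) (x / eta ^+ 2).
    apply: is_derive_eq (is_deriveN (is_deriveZ x dV)) _.
    by rewrite /GRing.scale /= mulrN opprK.
  exact: (@is_derive1_comp R expR _ eta).
have dl : is_derive eta (1 : R) (fun y : R => 4 * (2 - y)) (- 4).
  apply: is_derive_eq (is_deriveZ (4 : R) (is_deriveB (is_derive_cst (2 : R) eta 1) did)) _.
  by rewrite /GRing.scale /= sub0r mulrN1.
have dq : is_derive eta (1 : R) (fun y : R => y / (4 * (2 - y)))
    ((2 * (2 - eta) ^+ 2)^-1).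
  apply: is_derive_eq (is_deriveM did (@is_deriveV R _ eta _ 1 e2n0' dl)) _.
  by rewrite /GRing.scale /=; field.
apply: is_derive_eq (is_deriveB (is_deriveM dq dx)
  (is_deriveZ ((2 - x) / 8 * expR (- (x / 2))) dE)) _.
have -> : expR (x * (2^-1 - eta^-1)) = expR (x / 2) * expR (- (x / eta)).
  by rewrite -expRD mulrBr.
rewrite /GRing.scale /=.
have := expR_gt0 (x / 2); rewrite (expRN (x / 2)).
move: (expR (x / 2)) (expR (- (x / eta))) => c e c0.
have c0n : c != 0 by rewrite gt_eqF.
have xz : x * (2^-1 - eta^-1) != 0 by rewrite lt_eqF.
have xn0 : x != 0 by rewrite gt_eqF.
have e20 : eta - 2 != 0 by rewrite -oppr_eq0 opprB.
by field; rewrite e2n0 en0 e20 xn0 c0n.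
Qed.

End exponential_integral.

(** * The integral over the ratio of the two exponentials *)

Section power_density.
Context (R : realType) (rho : R).
Hypothesis rho01 : 0 < rho < 1.
Notation mu := (@lebesgue_measure R).

(** A weighted mean of [1 + rho] and [1 - rho], with weights [(1 + rho) r] and [1 - rho]. *)
Definition fading_ratio (r : R) : R :=
  ((1 + rho) ^+ 2 * r + (1 - rho) ^+ 2) / ((1 + rho) * r + (1 - rho)).
Notation w := fading_ratio.

Let rho_gt0 : 0 < rho. Proof. by case/andP: rho01. Qed.
Let l_gt0 : 0 < 1 + rho. Proof. by rewrite addr_gt0. Qed.
Let m_gt0 : 0 < 1 - rho. Proof. by rewrite subr_gt0; case/andP: rho01. Qed.

Let den_gt0 (r : R) : 0 <= r -> 0 < (1 + rho) * r + (1 - rho).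
Proof. by move=> r0; rewrite ltr_wpDl// mulr_ge0// ltW. Qed.

Lemma fading_ratio_gt0 (r : R) : 0 <= r -> 0 < w r.
Proof.
move=> r0; rewrite divr_gt0 ?den_gt0// ltr_wpDl ?exprn_gt0//.
by rewrite mulr_ge0// exprn_ge0// ltW.
Qed.

(** Holds because the eigenvalues sum to 2. It keeps [w] inside the domain of [Ffun], and its square
    brings in the [(1 + r)^2] of the integrand. *)
Let ratio_compl (r : R) : 0 <= r ->
  2 - w r = (1 + rho) * (1 - rho) * (1 + r) / ((1 + rho) * r + (1 - rho)).
Proof. by move=> r0; rewrite /fading_ratio; field; rewrite gt_eqF// den_gt0. Qed.

Let ratio_lt2 (r : R) : 0 <= r -> w r < 2.
Proof.
move=> r0; rewrite -subr_gt0 ratio_compl// divr_gt0 ?den_gt0//.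
by rewrite !mulr_gt0// ltr_pwDl.
Qed.

Let is_derive_ratio (r : R) : 0 <= r ->
  is_derive r (1 : R) w
    ((1 + rho) * (1 - rho) * (2 * rho) / ((1 + rho) * r + (1 - rho)) ^+ 2).
Proof.
move=> r0; have d0 : (1 + rho) * r + (1 - rho) != 0 by rewrite gt_eqF// den_gt0.
have did := @is_derive_id R R r 1.
have dlin (a b : R) : is_derive r (1 : R) (fun y : R => a * y + b) a.
  apply: is_derive_eq (is_deriveD (is_deriveZ a did) (is_derive_cst b r 1)) _.
  by rewrite /GRing.scale /= mulr1 addr0.
apply: is_derive_eq (is_deriveM (dlin _ _) (@is_deriveV R _ r _ 1 d0 (dlin _ _))) _.
by rewrite /GRing.scale /=; field.
Qed.

Let cvg_ratio : w r @[r --> +oo] --> 1 + rho.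
Proof.
have wE (r : R) : 0 <= r ->
    w r = (1 + rho) - (1 - rho) * (2 * rho) * ((1 + rho) * r + (1 - rho))^-1.
  by move=> r0; rewrite /fading_ratio; field; rewrite gt_eqF// den_gt0.
rewrite -[X in _ --> X]subr0 -[X in _ - X](mulr0 ((1 - rho) * (2 * rho))).
apply: (@cvg_trans _ ((fun r => (1 + rho) -
    (1 - rho) * (2 * rho) * ((1 + rho) * r + (1 - rho))^-1) @ +oo)).
  apply: near_eq_cvg; near=> r; rewrite wE//; near: r; exact: nbhs_pinfty_ge.
apply: cvgB; first exact: cvg_cst.
apply: cvgMr; apply/gtr0_cvgV0; last first.
  apply/cvgryPge => A; near=> r; apply: (@le_trans _ _ r).
    by near: r; apply: nbhs_pinfty_ge; exact: num_real.
  have r0 : 0 <= r by near: r; exact: nbhs_pinfty_ge.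
  by rewrite mulrDl mul1r -addrA lerDl addr_ge0 ?mulr_ge0// ltW.
near=> r; apply: den_gt0; near: r; exact: nbhs_pinfty_ge.
Unshelve. all: by end_near. Qed.

Lemma integral_fading_ratio (x : R) : 0 < x ->
  (\int[mu]_(r in `[0%R, +oo[)
     ((w r)^-1 * expR (- (x / w r)) / (1 + r) ^+ 2)%:E = (fg rho x)%:E)%E.
Proof.
move=> x0.
(* From [w'(r) / (2 - w r)^2 = 2 rho / ((1 - rho^2) (1 + r)^2)]; [c] inverts this constant. *)
pose c : R := (1 - rho ^+ 2) / (2 * rho).
pose F (r : R) := c * Ffun (w r) x.
have dF (r : R) : 0 <= r -> is_derive r (1 : R) F
    ((w r)^-1 * expR (- (x / w r)) / (1 + r) ^+ 2).
  move=> r0; have w02 : 0 < w r < 2 by rewrite fading_ratio_gt0// ratio_lt2.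
  have dcomp := @is_derive1_comp R (@Ffun R ^~ x) w r _ _
    (is_derive_Ffun x0 w02) (is_derive_ratio r0).
  apply: is_derive_eq (is_deriveZ c dcomp) _.
  rewrite /GRing.scale /= ratio_compl// /c.
  have : w r != 0 by rewrite gt_eqF// fading_ratio_gt0.
  move: (w r) (expR _) => v e v0; field.
  by rewrite v0 !gt_eqF ?den_gt0// ltr_pwDl.
have cw (r : R) : 0 <= r -> {for r, continuous w}.
  move=> r0; apply: differentiable_continuous; apply/derivable1_diffP.
  by have [] := is_derive_ratio r0.
rewrite (@ge0_continuous_FTC2y _ _ F 0 (c * Ffun (1 + rho) x)).
- rewrite /F -EFinB -mulrBr /fg /c; congr (_ * (_ - Ffun _ _))%:E.
  by rewrite /fading_ratio !mulr0 !add0r expr2 mulfK// gt_eqF.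
- move=> r r0; rewrite !mulr_ge0 ?expR_ge0 ?invr_ge0 ?exprn_ge0 ?addr_ge0//.
  by rewrite ltW// fading_ratio_gt0.
- apply: continuous_in_subspaceT => r; rewrite inE /= in_itv /= andbT => r0.
  have wn0 : w r != 0 by rewrite gt_eqF// fading_ratio_gt0.
  have cV : (w y)^-1 @[y --> r] --> (w r)^-1 by apply: cvgV => //; exact: cw.
  apply: cvgM; last first.
    apply: cvgV; first by rewrite expf_neq0// gt_eqF// ltr_pwDl.
    apply: (@continuous_comp _ _ _ (fun y : R => 1 + y) (fun y => y ^+ 2)).
      by apply: cvgD; [exact: cvg_cst|exact: cvg_id].
    exact: exprn_continuous.
  apply: cvgM => //.
  apply: (@continuous_comp _ _ _ (fun y : R => - (x / w y)) expR).
    by apply: cvgN; apply: cvgM; [exact: cvg_cst|].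
  exact: continuous_expR.
- apply: cvgMr; apply: (cvg_comp w (@Ffun R ^~ x)); first exact: cvg_ratio.
  have l02 : 0 < 1 + rho < 2 by case/andP: rho01 => ? ?; lra.
  suff : {for 1 + rho, continuous (@Ffun R ^~ x)} by [].
  apply: differentiable_continuous; apply/derivable1_diffP.
  by have [] := is_derive_Ffun x0 l02.
- by move=> r r0; have [] := dF r (ltW r0).
- apply: cvg_at_right_filter; apply: differentiable_continuous.
  by apply/derivable1_diffP; have [] := dF 0 (lexx 0).
- move=> r; rewrite in_itv /= andbT => r0.
  by rewrite derive1E; have [] := dF r (ltW r0).
Qed.

End power_density.

(** * The law of the ratio times an independent standard exponential *)

Section ratio_law.
Context (R : realType) (rho : R).
Hypothesis rho01 : 0 < rho < 1.
Notation mu := (@lebesgue_measure R).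
Notation p := (exponential_pdf (1 : R)).
Notation w := (fading_ratio rho).

Let pE (x : R) : 0 <= x -> p x = expR (- x).
Proof. by move=> x0; rewrite exponential_pdfE// mul1r mulN1r. Qed.

Let p0 (x : R) : x < 0 -> p x = 0.
Proof. exact: lt0_exponential_pdf. Qed.

Let p_ge0 (x : R) : 0 <= p x.
Proof. exact: exponential_pdf_ge0. Qed.

Let mp : measurable_fun setT p.
Proof. exact: measurable_exponential_pdf. Qed.

Let eq_integral_neq0 (f g : R -> \bar R) :
  measurable_fun setT f -> measurable_fun setT g ->
  (forall x, x != 0 -> f x = g x) -> (\int[mu]_x f x = \int[mu]_x g x)%E.
Proof.
move=> mf mg fg_eq.
rewrite (integral_lebesgueD0 mf) (integral_lebesgueD0 mg).
by apply: eq_integral => x; rewrite inE /= => -[_ /eqP x0]; exact: fg_eq.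
Qed.

Let integral_gamma2 (c : R) : 0 < c ->
  (\int[mu]_t (t * p (c * t))%:E = (c ^- 2)%:E)%E.
Proof.
move=> c0.
have int1 : (\int[mu]_t (t * p t)%:E = 1)%E.
  pose F (t : R) := - ((t + 1) * expR (- t)).
  have dF (t : R) : is_derive t (1 : R) F (t * expR (- t)).
    by apply: is_derive_eq; rewrite /GRing.scale /=; ring.
  have cE : continuous (fun t : R => expR (- t)).
    by move=> t; apply: continuous_comp; [exact: continuousN|exact: continuous_expR].
  transitivity (\int[mu]_(t in `[0%R, +oo[) (t * expR (- t))%:E)%E.
    rewrite [RHS]integral_mkcond; apply: eq_integral => t _.
    rewrite patchE; have [t0|t0] := leP 0 t.
      by rewrite mem_set ?pE//= in_itv /= t0.
    by rewrite memNset ?p0 ?mulr0//= in_itv /= leNgt t0.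
  rewrite (@ge0_continuous_FTC2y _ _ F 0 0).
  - by rewrite -EFinB /F oppr0 expR0 !add0r mulr1 opprK.
  - by move=> t t0; rewrite mulr_ge0 ?expR_ge0.
  - by apply: continuous_subspaceT => t; apply: cvgM; [exact: cvg_id|exact: cE].
  - rewrite -oppr0; apply: cvgN.
    (* For [t >= 1], [t + 1 <= 2 t] and [e^t >= t^2 / 2] bound [(t + 1) e^(-t)] by [4 / t]. *)
    have c1 : (4 / t : R) @[t --> +oo] --> (0 : R).
      rewrite -[X in _ --> X](mulr0 4); apply: cvgMr.
      by apply/gtr0_cvgV0; [exact: nbhs_pinfty_gt|exact: cvg_id].
    apply: (squeeze_cvgr _ (cvg_cst 0) c1).
    near=> t.
    have t1 : 1 <= t by near: t; apply: nbhs_pinfty_ge; exact: num_real.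
    have t0 : 0 < t by exact: lt_le_trans t1.
    rewrite mulr_ge0 ?expR_ge0 ?addr_ge0 ?(ltW t0)//=.
    have := expR_ge1Dxn 1 (ltW t0); rewrite expRN => et.
    have et2 : t ^+ 2 / 2 <= expR t.
      by apply: le_trans et; rewrite lerDr.
    rewrite ler_pdivrMr ?expR_gt0// mulrAC ler_pdivlMr//.
    apply: (@le_trans _ _ (2 * t ^+ 2)).
      by rewrite expr2; nra.
    by move: et2; rewrite ler_pdivrMr// => ?; lra.
  - by move=> t _; have [] := dF t.
  - apply: cvg_at_right_filter; apply: differentiable_continuous.
    by apply/derivable1_diffP; have [] := dF 0.
  - by move=> t _; rewrite derive1E; have [] := dF t.
have tp0 (t : R) : 0 <= t * p t.
  have [t0|t0] := leP 0 t; first by rewrite mulr_ge0.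
  by rewrite p0// mulr0.
have mtp : measurable_fun setT (fun t : R => (t * p t)%:E).
  by apply/measurable_EFinP; exact: measurable_funM.
have cn0 : c != 0 by rewrite gt_eqF.
have := @ge0_integral_affine R c 0 _ cn0 mtp (fun t => tp0 t).
rewrite int1 mule1 gtr0_norm// => E.
transitivity (c^-1%:E * \int[mu]_t ((c * t + 0) * p (c * t + 0))%:E)%E.
  rewrite -ge0_integralZl//; last 3 first.
  - apply: (measurableT_comp mtp).
    by apply: measurable_funD => //; exact: measurable_funM.
  - by move=> t _; exact: tp0.
  - by rewrite lee_fin invr_ge0 ltW.
  apply: eq_integral => t _; rewrite -EFinM addr0.
  by rewrite !mulrA mulVf// mul1r.
by rewrite E -EFinM -invfM -expr2.
Unshelve. all: by end_near. Qed.

Definition power_ratio (s t : R) : R :=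
  ((1 + rho) ^+ 2 * s + (1 - rho) ^+ 2 * t) / ((1 + rho) * s + (1 - rho) * t).
Notation W := power_ratio.

Let l_gt0 : 0 < 1 + rho. Proof. by case/andP: rho01 => ? ?; lra. Qed.
Let m_gt0 : 0 < 1 - rho. Proof. by case/andP: rho01 => ? ?; lra. Qed.

Let ratio_gt0 (s t : R) : 0 < s -> 0 <= t -> 0 < W s t.
Proof.
move=> s0 t0; rewrite /power_ratio.
have l0 := ltW l_gt0; have m0 := ltW m_gt0.
by rewrite divr_gt0// ltr_pwDl// ?mulr_gt0 ?mulr_ge0 ?exprn_gt0 ?exprn_ge0.
Qed.

Let ratio_scale (t r : R) : t != 0 -> W (t * r) t = w r.
Proof.
move=> t0; rewrite /power_ratio /fading_ratio.
have -> : (1 + rho) ^+ 2 * (t * r) + (1 - rho) ^+ 2 * t =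
  t * ((1 + rho) ^+ 2 * r + (1 - rho) ^+ 2) by ring.
have -> : (1 + rho) * (t * r) + (1 - rho) * t = t * ((1 + rho) * r + (1 - rho)) by ring.
by rewrite -mulf_div divff// mul1r.
Qed.

(* Density at [x] of the exponential law of mean [v]. *)
Let k (x v : R) : R := v^-1 * p (x / v).

Let normr_k (x v : R) : `|k x v| = `|v|^-1 * p (x / v).
Proof. by rewrite /k normrM normfV ger0_norm. Qed.

Lemma measurable_ratio : measurable_fun setT (fun z : R * R => W z.1 z.2).
Proof.
apply: measurable_funM; last apply: (measurableT_comp (@measurable_invr R));
  by apply: measurable_funD; apply: measurable_funM.
Qed.

Let measurable_k : measurable_fun setT (fun z : R * R => k z.1 z.2).
Proof.
have mi : measurable_fun setT (fun z : R * R => z.2^-1).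
  exact: (measurableT_comp (@measurable_invr R)).
apply: measurable_funM => //; apply: (measurableT_comp mp).
exact: measurable_funM.
Qed.

(* Substitute [s = t r].  The absolute value is vacuous where [p s * p t] does not
   vanish; it makes Tonelli applicable. *)
Let integral_ratio_density (x : R) : 0 < x ->
  (\int[mu]_s \int[mu]_t (`|k x (W s t)| * (p s * p t))%:E = (fg rho x)%:E)%E.
Proof.
move=> x0.
have mkx : measurable_fun setT (k x).
  have mxv : measurable_fun setT (fun v : R => (x, v)) by exact: measurable_fun_pair.
  exact: (measurableT_comp measurable_k mxv).
pose H (z : R * R) := (`|k x (W z.1 z.2)| * (p z.1 * p z.2))%:E.
have H0 z : (0 <= H z)%E by rewrite lee_fin !mulr_ge0.
have mH : measurable_fun setT H.
  apply/measurable_EFinP; apply: measurable_funM.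
    apply: measurableT_comp => //; exact: (measurableT_comp mkx measurable_ratio).
  by apply: measurable_funM; apply: (measurableT_comp mp).
(* The integrand in the variables [(t, r)], with [|t|] as Jacobian; [ratio_scale] makes [k] depend
   on [r] alone. *)
pose K (z : R * R) := (`|z.1| * (`|k x (w z.2)| * (p (z.1 * z.2) * p z.1)))%:E.
have K0 z : (0 <= K z)%E by rewrite lee_fin !mulr_ge0.
have mw : measurable_fun setT w.
  apply: measurable_funM; last apply: (measurableT_comp (@measurable_invr R));
    by apply: measurable_funD => //; apply: measurable_funM.
have mK : measurable_fun setT K.
  apply/measurable_EFinP; apply: measurable_funM; first exact: measurableT_comp.
  apply: measurable_funM.
    apply: measurableT_comp => //; apply: (measurableT_comp mkx).
    exact: (measurableT_comp mw).
  apply: measurable_funM; apply: (measurableT_comp mp) => //.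
  exact: measurable_funM.
rewrite -[LHS]/(\int[mu]_s \int[mu]_t H (s, t))%E.
rewrite fubini_tonelli_lebesgue//.
transitivity (\int[mu]_t \int[mu]_r K (t, r))%E.
  apply: eq_integral_neq0.
  - exact: (@measurable_fun_fubini_tonelli_G _ _ _ _ _ mu H mH H0).
  - exact: (@measurable_fun_fubini_tonelli_F _ _ _ _ _ mu K mK K0).
  move=> t t0.
  have mHt : measurable_fun setT (fun s => H (s, t)).
    by apply: (measurableT_comp mH); exact: measurable_fun_pair.
  have E := ge0_integral_affine 0 t0 mHt (fun=> H0 _).
  transitivity (`|t|%:E * (`|t|^-1%:E * \int[mu]_s H (s, t)))%E.
    by rewrite muleA -EFinM mulfV ?mul1e// normr_eq0.
  have mHta : measurable_fun setT (fun r => H (t * r + 0, t)).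
    apply: (measurableT_comp mHt).
    by apply: measurable_funD => //; exact: measurable_funM.
  have Z : (\int[mu]_r (`|t|%:E * H (t * r + 0, t)%R) =
      `|t|%:E * \int[mu]_r H (t * r + 0, t)%R)%E by apply: ge0_integralZl.
  rewrite -E -Z.
  apply: eq_integral => r _; rewrite /H /K -EFinM /= addr0.
  by rewrite ratio_scale.
rewrite fubini_tonelli_lebesgue//.
rewrite -integral_fading_ratio// [RHS]integral_mkcond.
apply: eq_integral => r _; rewrite patchE.
(* For [r < 0] and [t <> 0], one of [t r] and [t] is negative, so one of the two densities
   vanishes. *)
have [r0|r0] := leP 0 r; last first.
  rewrite memNset/= ?in_itv /= ?leNgt ?r0//.
  apply: integral0_eq => t _; rewrite /K /=.
  have [t0|t0|t0] := ltgtP 0 t.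
  - by rewrite (p0 (x := t * r)) ?mul0r ?mulr0// pmulr_rlt0.
  - by rewrite (p0 t0) !mulr0.
  - by rewrite -t0 normr0 mul0r.
rewrite mem_set/= ?in_itv /= ?r0//.
have w0 : 0 < w r by exact: fading_ratio_gt0.
have kE : k x (w r) = (w r)^-1 * expR (- (x / w r)).
  by rewrite /k pE// divr_ge0 ?ltW.
have c0 : 0 < 1 + r by rewrite ltr_pwDl.
(* For [t >= 0] the two densities multiply to [p ((1 + r) t)], and the integral over [t] becomes
   [integral_gamma2]. *)
transitivity (\int[mu]_t ((k x (w r))%:E * (t * p ((1 + r) * t))%:E))%E.
  apply: eq_integral => t _; rewrite /K /= -EFinM; congr EFin.
  have k0 : 0 <= k x (w r) by rewrite kE mulr_ge0 ?expR_ge0// invr_ge0 ltW.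
  rewrite (ger0_norm k0).
  have [t0|t0] := leP 0 t.
    rewrite ger0_norm// !pE ?mulr_ge0 ?(ltW c0)// -expRD mulrCA; congr (_ * (_ * expR _)).
    by ring.
  by rewrite (p0 t0) (p0 (x := (1 + r) * t)) ?pmulr_rlt0// !mulr0.
rewrite ge0_integralZl//; last 3 first.
- apply/measurable_EFinP; apply: measurable_funM => //.
  by apply: (measurableT_comp mp); exact: measurable_funM.
- move=> t _; rewrite lee_fin; have [t0|t0] := leP 0 t; first by rewrite mulr_ge0.
  by rewrite (p0 (x := (1 + r) * t)) ?pmulr_rlt0// mulr0.
- by rewrite lee_fin kE mulr_ge0 ?expR_ge0// invr_ge0 ltW.
by rewrite integral_gamma2// -EFinM kE.
Qed.

Let integral_stdexp2 (F : R * R -> \bar R) :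
  measurable_fun setT F -> (forall z, 0 <= F z)%E ->
  (\int[@stdexp R]_s \int[@stdexp R]_t F (s, t) =
   \int[mu]_s \int[mu]_t (F (s, t) * (p s * p t)%:E))%E.
Proof. by apply: ge0_integral_density2 p_ge0 mp _ => A mA; exact: stdexpE. Qed.

(** Given [s] and [t], the product is exponential of mean [W s t], with density [k] at [x]; Tonelli
    then moves [x] outermost, where the two inner integrals give [fg rho x]. *)
Lemma stdexp_ratio_law (A : set R) : measurable A ->
  (\int[@stdexp R]_s \int[@stdexp R]_t \int[@stdexp R]_v (\1_A (W s t * v))%:E =
   \int[mu]_(x in A `&` `]0%R, +oo[) (fg rho x)%:E)%E.
Proof.
move=> mA.
have mI : measurable_fun setT (\1_A : R -> R) by exact: measurable_indic.
pose B (z : R * R * R) : \bar R := (\1_A (W z.1.1 z.1.2 * z.2) : R)%:E.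
have mB : measurable_fun setT B.
  apply/measurable_EFinP; apply: (measurableT_comp mI).
  by apply: measurable_funM => //; exact: (measurableT_comp measurable_ratio measurable_fst).
have B0 z : (0 <= B z)%E by rewrite lee_fin.
pose Q (z : R * R) := (\int[@stdexp R]_v B (z, v))%E.
have mQ : measurable_fun setT Q.
  exact: (@measurable_fun_fubini_tonelli_F _ _ _ _ _ (@stdexp R) B mB B0).
have Q0 z : (0 <= Q z)%E by exact: integral_ge0.
apply: (etrans (integral_stdexp2 mQ Q0)).
pose Phi (z : R * R * R) : \bar R :=
  (\1_A z.1.2 * (`|k z.1.2 (W z.1.1 z.2)| * (p z.1.1 * p z.2)))%:E.
have Phi0 z : (0 <= Phi z)%E by rewrite lee_fin !mulr_ge0.
have mPhi : measurable_fun setT Phi.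
  apply/measurable_EFinP; apply: measurable_funM.
    apply: (measurableT_comp mI).
    exact: (measurableT_comp measurable_snd measurable_fst).
  apply: measurable_funM; last first.
    apply: measurable_funM; apply: (measurableT_comp mp) => //.
    exact: (measurableT_comp measurable_fst measurable_fst).
  apply: measurableT_comp => //.
  have m1 : measurable_fun setT (fun z : R * R * R => (z.1.1, z.2)).
    apply: measurable_fun_pair => //.
    exact: (measurableT_comp measurable_fst measurable_fst).
  have m2 := measurableT_comp measurable_ratio m1.
  have m3 : measurable_fun setT (fun z : R * R * R => (z.1.2, W z.1.1 z.2)).
    apply: measurable_fun_pair => //.
    exact: (measurableT_comp measurable_snd measurable_fst).
  exact: (measurableT_comp measurable_k m3).
pose Psi (z : R * R) := (\int[mu]_t Phi (z, t))%E.
have mPsi : measurable_fun setT Psi.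
  exact: (@measurable_fun_fubini_tonelli_F _ _ _ _ _ mu Phi mPhi Phi0).
have Psi0 z : (0 <= Psi z)%E by exact: integral_ge0.
transitivity (\int[mu]_s \int[mu]_x Psi (s, x))%E.
  have mQp : measurable_fun setT (fun z : R * R => Q z * (p z.1 * p z.2)%:E)%E.
    apply: emeasurable_funM => //; apply/measurable_EFinP.
    by apply: measurable_funM; exact: (measurableT_comp mp).
  have Qp0 (z : R * R) : (0 <= Q z * (p z.1 * p z.2)%:E)%E.
    by rewrite mule_ge0// lee_fin mulr_ge0.
  (* At [s = t = 0] the ratio is 0 although the densities do not vanish. Dropping the null set
     [s = 0] leaves [W s t > 0] wherever [p s * p t] is nonzero. *)
  apply: eq_integral_neq0.
  - exact: (@measurable_fun_fubini_tonelli_F _ _ _ _ _ mu _ mQp Qp0).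
  - exact: (@measurable_fun_fubini_tonelli_F _ _ _ _ _ mu Psi mPsi Psi0).
  move=> s s0.
  pose Phis (z : R * R) := Phi ((s, z.2), z.1).
  have mPhis : measurable_fun setT Phis.
    apply: (measurableT_comp mPhi); apply: measurable_fun_pair => //.
    exact: measurable_fun_pair.
  rewrite -[RHS]/(\int[mu]_x \int[mu]_t Phis (t, x))%E.
  rewrite -(@fubini_tonelli_lebesgue R Phis mPhis (fun=> Phi0 _)).
  apply: eq_integral => t _.
  have zero : p s * p t = 0 ->
      (Q (s, t) * (p s * p t)%:E = \int[mu]_x Phis (t, x))%E.
    move=> st0; rewrite st0 mule0 integral0_eq// => x _.
    by rewrite /Phis /Phi /= st0 !mulr0.
  have [s_gt0|s_lt0|s_eq0] := ltgtP 0 s; last by rewrite s_eq0 eqxx in s0.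
    have [t0|t0] := leP 0 t; last by apply: zero; rewrite (p0 t0) mulr0.
    have W0 := ratio_gt0 s_gt0 t0.
    have Wn0 : W s t != 0 by rewrite gt_eqF.
    pose g (x : R) : \bar R := (\1_A x * p (x / W s t))%:E.
    have mg : measurable_fun setT g.
      apply/measurable_EFinP; apply: measurable_funM => //.
      by apply: (measurableT_comp mp); exact: measurable_funM.
    have g0 x : (0 <= g x)%E by rewrite lee_fin mulr_ge0.
    have QE : Q (s, t) = (`|W s t|^-1%:E * \int[mu]_x g x)%E.
      apply: etrans (ge0_integral_affine 0 Wn0 mg g0).
      have mBst : measurable_fun setT (fun v => B (s, t, v)).
        by apply: (measurableT_comp mB); exact: measurable_fun_pair.
      apply: (etrans (ge0_integral_stdexp mBst (fun=> B0 _))).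
      apply: eq_integral => v _; rewrite /B /g /= addr0 EFinM.
      by rewrite [_ / _]mulrAC mulfV// mul1r.
    rewrite QE muleAC -EFinM.
    have c0 : 0 <= `|W s t|^-1 * (p s * p t) by rewrite !mulr_ge0// invr_ge0.
    transitivity (\int[mu]_x ((`|W s t|^-1 * (p s * p t))%:E * g x))%E.
      by rewrite ge0_integralZl.
    apply: eq_integral => x _; rewrite /g /Phis /Phi /= normr_k -EFinM; congr EFin.
    by move: (W s t) => v; ring.
  by apply: zero; rewrite (p0 s_lt0) mul0r.
rewrite fubini_tonelli_lebesgue//.
pose f (x : R) := (\int[mu]_s Psi (s, x))%E.
have mf : measurable_fun setT f.
  exact: (@measurable_fun_fubini_tonelli_G _ _ _ _ _ mu Psi mPsi Psi0).
(* The open half-line excludes [x = 0], where [f] need not vanish. *)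
rewrite -[LHS]/(\int[mu]_x f x)%E (integral_lebesgueD0 mf).
rewrite integral_mkcond [RHS]integral_mkcond; apply: eq_integral => x _.
rewrite !patchE.
have [->|x0] := eqVneq x 0.
  rewrite memNset/=; last by case.
  by rewrite memNset//= in_itv /= ltxx => -[].
rewrite mem_set/=; last by split=> //; exact/eqP.
have [xgt0|xlt0|xeq0] := ltgtP 0 x; last by rewrite xeq0 eqxx in x0.
  have [Ax|nAx] := pselect (A x).
    rewrite mem_set/= ?in_itv /= ?xgt0// -(integral_ratio_density xgt0).
    apply: eq_integral => s _; apply: eq_integral => t _.
    by rewrite /Phi /= indicE mem_set// mul1r.
  rewrite memNset//=; last by case.
  apply: integral0_eq => s _; apply: integral0_eq => t _.
  by rewrite /Phi /= indicE memNset// mul0r.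
rewrite memNset//=; last by rewrite in_itv /= andbT ltNge (ltW xlt0) => -[].
apply: integral0_eq => s _; apply: integral0_eq => t _; rewrite /Phi /=.
have [s0|s0] := leP 0 s; last by rewrite (p0 s0) mul0r !mulr0.
have [t0|t0] := leP 0 t; last by rewrite (p0 t0) !mulr0.
have W0 : 0 <= W s t.
  have l0 := ltW l_gt0; have m0 := ltW m_gt0.
  by rewrite divr_ge0 ?addr_ge0 ?mulr_ge0 ?exprn_ge0.
(* If [W s t = 0], then [k] is 0 since the inverse of 0 is 0; otherwise [x / W s t] is negative,
   where [p] vanishes. *)
move: W0; rewrite le_eqVlt => /predU1P[<-|W0].
  by rewrite /k invr0 mul0r normr0 mul0r mulr0.
by rewrite /k (p0 (x := x / _)) ?mulr0 ?normr0 ?mul0r ?mulr0// pmulr_llt0// invr_gt0.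
Qed.

End ratio_law.

(** * The power gain as a rational function of the real coordinates *)

Section gg_formula.
Context (R : realType).

Lemma cabs2_divr (z : R[i]) (r : R) : cabs2 (z / r%:C%C) = cabs2 z / r ^+ 2.
Proof.
have -> : (r%:C%C)^-1 = (r^-1)%:C%C :> R[i] by rewrite fmorphV.
case: z => a b; rewrite /cabs2 /= !mulr0 subr0 add0r !exprMn -exprVn.
by rewrite -mulrDl.
Qed.

Lemma cabs2_ge0 (z : R[i]) : 0 <= cabs2 z.
Proof. by rewrite addr_ge0 ?sqr_ge0. Qed.

(** The entries of [R h_2] are [a1 + i b1] and [a2 + i b2]; the numerator is the squared modulus of
    [h_1^H R h_2] and the denominator is [h_2^H R h_2]. *)
Lemma ggE (T : Type) (rho : R) (S : 'M[R]_2) (X : Idx -> T -> R) (t : T) :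
  S^T = S -> S *m S = Rmat rho ->
  let a1 := X (false, 1, 0) t + rho * X (false, 1, 1) t in
  let b1 := X (true, 1, 0) t + rho * X (true, 1, 1) t in
  let a2 := rho * X (false, 1, 0) t + X (false, 1, 1) t in
  let b2 := rho * X (true, 1, 0) t + X (true, 1, 1) t in
  gg S X t =
  ((a1 * X (false, 0, 0) t + b1 * X (true, 0, 0) t +
    (a2 * X (false, 0, 1) t + b2 * X (true, 0, 1) t)) ^+ 2 +
   (b1 * X (false, 0, 0) t - a1 * X (true, 0, 0) t +
    (b2 * X (false, 0, 1) t - a2 * X (true, 0, 1) t)) ^+ 2) /
  (X (false, 1, 0) t * a1 + X (true, 1, 0) t * b1 +
   X (false, 1, 1) t * a2 + X (true, 1, 1) t * b2).
Proof.
move=> ST SS a1 b1 a2 b2.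
rewrite /gg /gcplx cabs2_divr /cvnorm sqr_sqrtr; last first.
  by apply: sumr_ge0 => k _; exact: cabs2_ge0.
have S10 : S 1 0 = S 0 1 by rewrite -[in RHS]ST mxE.
have lift1 : lift ord0 ord0 = 1 :> 'I_2 by exact: val_inj.
have sum2 (V : nmodType) (f : 'I_2 -> V) : \sum_(k < 2) f k = f 0 + f 1.
  by rewrite !big_ord_recl big_ord0 addr0 lift1.
have ent i j : S i 0 * S 0 j + S i 1 * S 1 j = Rmat rho i j.
  by rewrite -SS mxE sum2.
have := ent 0 0; have := ent 0 1; have := ent 1 1; rewrite !S10 !mxE /=.
rewrite !(mxE, sum2) /cabs2 S10 /=.
move: (S 0 0) (S 0 1) (S 1 1) => p q r e11 e01 e00.
(* Writing the entries of [Rmat rho] as those of the square of [S] turns the claim into polynomial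
   identities in [p], [q], [r], which [ring] proves. *)
have -> : a1 = (p * p + q * q) * X (false, 1, 0) t + (p * q + q * r) * X (false, 1, 1) t.
  by rewrite e00 e01 mul1r.
have -> : b1 = (p * p + q * q) * X (true, 1, 0) t + (p * q + q * r) * X (true, 1, 1) t.
  by rewrite e00 e01 mul1r.
have -> : a2 = (p * q + q * r) * X (false, 1, 0) t + (q * q + r * r) * X (false, 1, 1) t.
  by rewrite e11 e01 mul1r.
have -> : b2 = (p * q + q * r) * X (true, 1, 0) t + (q * q + r * r) * X (true, 1, 1) t.
  by rewrite e11 e01 mul1r.
by congr (_ / _); [congr (_ ^+ 2 + _ ^+ 2)|]; ring.
Qed.

End gg_formula.

(** * Assembly: conditioning on the second vector *)

Section main.
Context (R : realType) (d : measure_display) (T : measurableType d)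
  (P : probability T R) (rho : R).
Hypothesis rho01 : 0 < rho < 1.
Variables (S : 'M[R]_2) (X : Idx -> T -> R).
Hypotheses (ST : S^T = S) (SS : S *m S = Rmat rho).
Hypotheses (mX : forall i, measurable_fun setT (X i))
  (X_indep : mutually_independent P X)
  (X_halfnormal : forall i (A : set R), measurable A ->
    P (X i @^-1` A) = halfnormal R A).
Notation gam := (halfnormal R).

(** The quadratic form [h_2^H R h_2] at [h_2 = (u1 + i v1, u2 + i v2)]. *)
Let den (u1 v1 u2 v2 : R) : R :=
  u1 * (u1 + rho * u2) + v1 * (v1 + rho * v2) +
  u2 * (rho * u1 + u2) + v2 * (rho * v1 + v2).

Let gform (u1 v1 u2 v2 x y z w : R) : R :=
  (((u1 + rho * u2) * x + (v1 + rho * v2) * y +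
    ((rho * u1 + u2) * z + (rho * v1 + v2) * w)) ^+ 2 +
   ((v1 + rho * v2) * x - (u1 + rho * u2) * y +
    ((rho * v1 + v2) * z - (rho * u1 + u2) * w)) ^+ 2) / den u1 v1 u2 v2.

Let measurable_gform d' (W : measurableType d') (u1 v1 u2 v2 x y z w : W -> R) :
  measurable_fun setT u1 -> measurable_fun setT v1 -> measurable_fun setT u2 ->
  measurable_fun setT v2 -> measurable_fun setT x -> measurable_fun setT y ->
  measurable_fun setT z -> measurable_fun setT w ->
  measurable_fun setT (fun a => gform (u1 a) (v1 a) (u2 a) (v2 a)
    (x a) (y a) (z a) (w a)).
Proof.
move=> *; rewrite /gform /den; apply: measurable_funM; first by measurable_arith.
apply: (measurableT_comp (@measurable_invr R)).
by measurable_arith.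
Qed.

Lemma gg_law (A : set R) : measurable A ->
  P (gg S X @^-1` A) =
  (\int[@lebesgue_measure R]_(x in A `&` `]0%R, +oo[) (fg rho x)%:E)%E.
Proof.
move=> mA; have mI : measurable_fun setT (\1_A : R -> R) by exact: measurable_indic.
have gE t : gg S X t = gform (X (false, 1, 0) t) (X (true, 1, 0) t)
    (X (false, 1, 1) t) (X (true, 1, 1) t) (X (false, 0, 0) t) (X (true, 0, 0) t)
    (X (false, 0, 1) t) (X (true, 0, 1) t).
  exact: ggE ST SS.
have mg : measurable_fun setT (gg S X).
  by rewrite (funext gE); exact: measurable_gform.
have -> : P (gg S X @^-1` A) = (\int[P]_t (\1_A (gg S X t))%:E)%E.
  rewrite integral_indic ?setIT//.
  by rewrite -[X in measurable X]setTI; exact: mg.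
pose F (z : R * R * R * R * R * R * R * R) : \bar R :=
  (\1_A (gform z.1.1.1.1.1.1.1 z.1.1.1.1.1.1.2 z.1.1.1.1.1.2 z.1.1.1.1.2
     z.1.1.1.2 z.1.1.2 z.1.2 z.2))%:E.
have mF : measurable_fun setT F.
  have p1 : measurable_fun setT (fst : R * R * R * R * R * R * R * R -> _).
    exact: measurable_fst.
  have p2 := measurableT_comp measurable_fst p1.
  have p3 := measurableT_comp measurable_fst p2.
  have p4 := measurableT_comp measurable_fst p3.
  have p5 := measurableT_comp measurable_fst p4.
  have p6 := measurableT_comp measurable_fst p5.
  have p7 := measurableT_comp measurable_fst p6.
  apply/measurable_EFinP; apply: (measurableT_comp mI).
  exact: (measurable_gform p7 (measurableT_comp measurable_snd p6)
    (measurableT_comp measurable_snd p5) (measurableT_comp measurable_snd p4)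
    (measurableT_comp measurable_snd p3) (measurableT_comp measurable_snd p2)
    (measurableT_comp measurable_snd p1) measurable_snd).
have F0 z : (0 <= F z)%E by rewrite lee_fin.
under eq_integral do rewrite gE.
(* The coordinates of [h_2] come first, so that the four inner integrals run over [h_1] with [h_2]
   fixed. *)
pose Z t := (X (false, 1, 0) t, X (true, 1, 0) t,
    X (false, 1, 1) t, X (true, 1, 1) t, X (false, 0, 0) t, X (true, 0, 0) t,
    X (false, 0, 1) t, X (true, 0, 1) t).
rewrite -[LHS]/(\int[P]_t F (Z t))%E.
pose i (b : bool) (j k : 'I_2) : Idx := (b, j, k).
have idx_uniq : uniq [:: i false 1 0; i true 1 0; i false 1 1; i true 1 1;
  i false 0 0; i true 0 0; i false 0 1; i true 0 1] by [].
apply: (etrans (halfnormal8_integral mX X_indep X_halfnormal idx_uniq mF F0)).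
rewrite -(stdexp_ratio_law rho01 mA).
pose B (z : R * R * R) : \bar R := (\1_A (power_ratio rho z.1.1 z.1.2 * z.2) : R)%:E.
have mB : measurable_fun setT B.
  apply/measurable_EFinP; apply: (measurableT_comp mI).
  apply: measurable_funM => //; exact: (measurableT_comp (measurable_ratio rho) measurable_fst).
have B0 z : (0 <= B z)%E by rewrite lee_fin.
pose Q (z : R * R) := (\int[@stdexp R]_v B (z, v))%E.
have mQ : measurable_fun setT Q.
  exact: (@measurable_fun_fubini_tonelli_F _ _ _ _ _ (@stdexp R) B mB B0).
have Q0 z : (0 <= Q z)%E by exact: integral_ge0.
apply: etrans (halfnormal4_sum_diff_law mQ Q0).
apply: eq_integral => u1 _; apply: eq_integral => v1 _.
apply: eq_integral => u2 _; apply: eq_integral => v2 _.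
pose f (n : R) : \bar R := (\1_A (n / den u1 v1 u2 v2))%:E.
have mf : measurable_fun setT f.
  by apply/measurable_EFinP; apply: (measurableT_comp mI); exact: measurable_funM.
have f0 n : (0 <= f n)%E by rewrite lee_fin.
apply: (etrans (halfnormal4_form_law (u1 + rho * u2) (v1 + rho * v2)
  (rho * u1 + u2) (rho * v1 + v2) mf f0)).
rewrite /Q; apply: eq_integral => v _; rewrite /f /B /power_ratio /=.
(* Diagonalisation of [R]: with [s] and [t] half the squared moduli of the sum and the difference of
   the entries of [h_2], [|R h_2|^2 = l^2 s + m^2 t] and [h_2^H R h_2 = l s + m t]. *)
congr (\1_A _)%:E; rewrite mulrAC; by congr (_ / _ * _); rewrite /den; field.
Qed.

End main.

Theorem theorem1 (R : realType) (d : measure_display) (T : measurableType d)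
  (P : probability T R) (rho : R) (hrho : 0 < rho < 1)
  (S : 'M[R]_2) (hSpsd : psd S) (hSsq : S *m S = Rmat rho)
  (X : Idx -> {RV P >-> R})
  (hind : mutually_independent P (fun i => (X i : T -> R)))
  (hgauss : forall i (A : set R), measurable A ->
      P (X i @^-1` A) = normal_prob 0 (Num.sqrt (2^-1)) A) :
  forall A : set R, measurable A ->
    P (gg S (fun i => (X i : T -> R)) @^-1` A) =
    (\int[@lebesgue_measure R]_(x in A `&` `]0%R, +oo[) (fg rho x)%:E)%E.
Proof.
move=> A mA; have [ST _] := hSpsd.
by apply: (gg_law hrho ST hSsq) => // i; exact: measurable_funPT.
Qed.
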